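(* Let $E$ be a real or complex vector space of countably infinite dimension with a fixed Hamel basis $(e_n)_{n=1}^\infty$. Suppose $f:\Sigma_{<\infty}(A_\infty)\to[0,\infty)$ is admissible. Then, given $\epsilon>0$, there is a block subspace $V\in\mathcal B(E)$ and a strategy $\Phi$ which is $(\epsilon,V)$-effective for $f$; that is, for every sequence $(V_j)_{j=1}^\infty$ in $\mathcal B(E)$ with $V_j\subset V$ for all $j$ there exists $n\in\mathbb N$ such that $$f(\Phi(\emptyset;V_1,\ldots,V_n))<\sup_{W\in\mathcal B(E)}f'_W(\emptyset)+\epsilon .$$
   Context: $\mathcal T$ is the finest vector topology on $E$: $U\subset E$ is $\mathcal T$-open iff $U\cap F$ is open in $F$ for every finite-dimensional subspace $F$. $E^{(m)}=\mathrm{span}\{e_{m+1},e_{m+2},\ldots\}$. $\|\sum a_je_j\|_\infty=\max_j|a_j|$, $A_\infty=\{x\in E:0<\|x\|_\infty\le1\}$, $S_\infty=\{x\in E:\|x\|_\infty=1\}$. A finite or infinite sequence $(v_k)$ of nonzero vectors is a block basis of $(e_n)$ if there are integers $0=p_0<p_1<\cdots$ with $v_k\in\mathrm{span}\{e_{p_{k-1}+1},\ldots,e_{p_k}\}$. $\Sigma_n(E)$ is the set of block bases of length $n$, $\Sigma_0(E)=\{\emptyset\}$, $\Sigma_{<\infty}(E)=\bigcup_{n\ge0}\Sigma_n(E)$; for $A\subset E$, $\Sigma_{<\infty}(A)$ is the set of those with all entries in $A$. $\mathcal B(E)$ is the collection of linear spans of infinite block bases. $f:\Sigma_{<\infty}(A_\infty)\to[0,\infty)$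 is admissible if it is bounded and: (i) given $\epsilon>0$ there is a sequence $(U_n)$ of $\mathcal T$-neighborhoods of $0$ such that if $(u_1,\ldots,u_r),(v_1,\ldots,v_r)\in\Sigma_{<\infty}(S_\infty)$ and $u_j-v_j\in U_j$ for $1\le j\le r$, then $|f(\lambda_1u_1,\ldots,\lambda_ru_r)-f(\lambda_1v_1,\ldots,\lambda_rv_r)|<\epsilon$ for all $(\lambda_1,\ldots,\lambda_r)\in(0,1]^r$; (ii) given $\epsilon>0$ and $(u_1,\ldots,u_r)\in\Sigma_{<\infty}(S_\infty)$ there is $\delta>0$ such that if $0<\lambda_j,\mu_j\le1$ and $\max_j|\lambda_j-\mu_j|\le\delta$, then $|f(\lambda_1u_1,\ldots,\lambda_ru_r,v_1,\ldots,v_s)-f(\mu_1u_1,\ldots,\mu_ru_r,v_1,\ldots,v_s)|<\epsilon$ whenever $(u_1,\ldots,u_r,v_1,\ldots,v_s)\in\Sigma_{<\infty}(A_\infty)$. Convention: $f=+\infty$ at any finite sequence of vectors of $E$ not in $\Sigma_{<\infty}(A_\infty)$. For $W\in\mathcal B(E)$, $$f'_W(u_1,\ldots,u_n)=\lim_{m\to\infty}\inf\{f(u_1,\ldots,u_n,v_1,\ldots,v_s):\ v_1,\ldots,v_s\in W\cap E^{(m)},\ s\ge1\}.$$ A strategy is a map $\Phi:\Sigma_{<\infty}(E)\times\mathcal B(E)\to\Sigma_{<\infty}(E)$ such that $\Phi(u_1,\ldots,u_n;V)=(u_1,\ldots,u_n,u_{n+1})$ with $u_{n+1}\in V$. Iterating,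 $\Phi(\emptyset;V_1,\ldots,V_n)=(u_1,\ldots,u_n)$ where $(u_1,\ldots,u_k)=\Phi(u_1,\ldots,u_{k-1};V_k)$ for $1\le k\le n$. *)

(* Defs.v *)
From mathcomp Require Import all_boot all_order all_algebra.
From mathcomp Require Import all_classical all_reals all_analysis.
From mathcomp Require Import complex.

Set Implicit Arguments.
Unset Strict Implicit.
Unset Printing Implicit Defensive.

Import Order.TTheory GRing.Theory Num.Theory.
Import numFieldNormedType.Exports.

Local Open Scope classical_set_scope.
Local Open Scope ring_scope.

Variant scalar_kind := RealScalars | ComplexScalars.

Definition scalar_field (R : realType) (k : scalar_kind) : numFieldType :=
  match k with
  | RealScalars => R
  | ComplexScalars => R[i]
  end.

(* Everything below is uniform in the scalar field K, used with K = R or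
   K = R[i].  Norms, the scalars lambda in (0,1] and the moduli delta are taken
   in K: in the order of R[i], x <= y forces y - x to be real, so that
   0 < x <= 1 there means that x is a real number of (0,1]. *)
Section BlockBases.
Variables (K : numFieldType) (E : lmodType K).
Implicit Types (e : nat -> E) (A U V W : set E) (s u v : seq E).

Definition lin_span A : set E :=
  [set x | exists (n : nat) (c : 'I_n -> K) (w : 'I_n -> E),
     (forall i, A (w i)) /\ x = \sum_(i < n) c i *: w i].

Definition lin_free (n : nat) (w : 'I_n -> E) : Prop :=
  forall c : 'I_n -> K, \sum_(i < n) c i *: w i = 0 -> forall i, c i = 0.

(* Indices start at 0: e j stands for $e_{j+1}$. *)
Definition hamel_basis e : Prop :=
  (forall n : nat, lin_free (fun i : 'I_n => e i)) /\
  lin_span (range e) = [set: E].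

(* A finite-dimensional subspace F with basis w carries the topology
   transported from K^n along the coordinate isomorphism; the set below is the
   image of the intersection of U with F under that isomorphism. *)
Definition T_open U : Prop :=
  forall (n : nat) (w : 'I_n -> E), lin_free w ->
    open [set c : 'rV[K]_n | U (\sum_(i < n) c ord0 i *: w i)].

Definition T_nbhs0 U : Prop := exists O, [/\ T_open O, O 0 & O `<=` U].

(* $E^{(m)}$, spanned by the basis vectors of (0-based) index at least m. *)
Definition tail_space e (m : nat) : set E :=
  lin_span [set e j | j in [set j | (m <= j)%N]].

(* The coefficients of x on e: unique up to trailing zeros if e is a basis. *)
Definition coords e (x : E) : seq K :=
  xget [::] [set a : seq K | x = \sum_(j < size a) a`_j *: e j].

Definition max_norm e (x : E) : K :=
  \big[Num.max/0]_(a <- coords e x) `|a|.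

Definition A_infty e : set E := [set x | 0 < max_norm e x <= 1].
Definition S_infty e : set E := [set x | max_norm e x = 1].

Definition in_block e (p : nat -> nat) (k : nat) (x : E) : Prop :=
  x != 0 /\ lin_span [set e j | j in [set j | (p k <= j < p k.+1)%N]] x.

(* $\Sigma_{<\infty}(A)$; the values of p beyond size s are irrelevant. *)
Definition fin_block_basis e A s : Prop :=
  (exists p : nat -> nat,
     [/\ p 0%N = 0%N,
         forall k, (k < size s)%N -> (p k < p k.+1)%N &
         forall k, (k < size s)%N -> in_block e p k s`_k]) /\
  (forall x, x \in s -> A x).

Definition inf_block_basis e (v : nat -> E) : Prop :=
  exists p : nat -> nat,
    [/\ p 0%N = 0%N,
        forall k, (p k < p k.+1)%N &
        forall k, in_block e p k (v k)].

(* $\mathcal B(E)$ *)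
Definition block_subspaces e : set (set E) :=
  [set W | exists2 v : nat -> E, inf_block_basis e v & W = lin_span (range v)].

Definition scale_tuple (r : nat) (l : r.-tuple K) (u : r.-tuple E) :
    r.-tuple E :=
  [tuple tnth l j *: tnth u j | j < r].

Definition unit_scalars (r : nat) (l : r.-tuple K) : Prop :=
  forall j, 0 < tnth l j <= 1.

Definition strategy e (Phi : seq E -> set E -> seq E) : Prop :=
  forall u V, fin_block_basis e [set: E] u -> block_subspaces e V ->
    fin_block_basis e [set: E] (Phi u V) /\
    exists2 x, V x & Phi u V = rcons u x.

(* $\Phi(\emptyset;V_1,\ldots,V_n)$, with Vs j standing for $V_{j+1}$. *)
Fixpoint play (Phi : seq E -> set E -> seq E) (Vs : nat -> set E) (n : nat) :
    seq E :=
  if n is n'.+1 then Phi (play Phi Vs n') (Vs n') else [::].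

End BlockBases.

(* A function on $\Sigma_{<\infty}(A_\infty)$ is represented by a function on
   all finite sequences, whose values elsewhere are never used. *)
Section Functionals.
Variables (R : realType) (K : numFieldType) (E : lmodType K).
Implicit Types (e : nat -> E) (f : seq E -> R) (V W : set E).

Definition admissible e f : Prop :=
  [/\ forall s, fin_block_basis e (A_infty e) s -> 0 <= f s,
      exists M : R, forall s, fin_block_basis e (A_infty e) s -> f s <= M,
      forall eps : R, 0 < eps ->
        exists2 U : nat -> set E, (forall n, T_nbhs0 (U n)) &
          forall (r : nat) (u v : r.-tuple E),
            fin_block_basis e (S_infty e) u ->
            fin_block_basis e (S_infty e) v ->
            (forall j : 'I_r, U j (tnth u j - tnth v j)) ->
            forall l : r.-tuple K, unit_scalars l ->
              `|f (scale_tuple l u) - f (scale_tuple l v)| < eps &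
      forall (eps : R) (r : nat) (u : r.-tuple E), 0 < eps ->
        fin_block_basis e (S_infty e) u ->
        exists2 delta : K, 0 < delta &
          forall l m : r.-tuple K, unit_scalars l -> unit_scalars m ->
            (forall j, `|tnth l j - tnth m j| <= delta) ->
            forall v : seq E, fin_block_basis e (A_infty e) (u ++ v) ->
              `|f (scale_tuple l u ++ v) - f (scale_tuple m u ++ v)| < eps].

Definition extended e f (s : seq E) : \bar R :=
  if `[< fin_block_basis e (A_infty e) s >] then (f s)%:E else +oo%E.

(* $f'_W(u_1,\ldots,u_n)$ *)
Definition lower_limit e f W (u : seq E) : \bar R :=
  limn (fun m : nat =>
    ereal_inf [set extended e f (u ++ v) | v in
      [set v : seq E | (0 < size v)%N /\
         forall x, x \in v -> (W `&` tail_space e m) x]]).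

Definition effective e f (eps : R) V (Phi : seq E -> set E -> seq E) : Prop :=
  forall Vs : nat -> set E,
    (forall j, block_subspaces e (Vs j) /\ Vs j `<=` V) ->
    exists2 n : nat, (0 < n)%N &
      (extended e f (play Phi Vs n) <
       ereal_sup [set lower_limit e f W [::] | W in block_subspaces e]
         + eps%:E)%E.

End Functionals.

(* Main.v *)
Require Import Defs.
From mathcomp Require Import all_boot all_order all_algebra.
From mathcomp Require Import all_classical all_reals all_analysis.
From mathcomp Require Import complex lra.

Set Implicit Arguments.
Unset Strict Implicit.
Unset Printing Implicit Defensive.

Import Order.TTheory GRing.Theory Num.Theory.
Import numFieldNormedType.Exports.
Local Open Scope classical_set_scope.
Local Open Scope ring_scope.

(** The proof is Gowers' combinatorial forcing for an open game, run on a
discretised copy of the space of block sequences.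

Discretisation.  Vectors of the unit sphere supported in a fixed finite set of
coordinates form a totally bounded set, and so do the scalars of (0,1].  The two
continuity conditions of admissibility therefore give a rounding procedure
(exists_rounding): a block sequence u is replaced, one entry after the other, by
a block sequence round r u with the same supports, in such a way that f changes
by at most a prescribed amount and that only finitely many rounded sequences live
below any given coordinate.  Each new rounded entry is computed from the rounded
past and the actual new vector, so that a play of the game can be followed
through its rounded image.

The game.  Put theta = sup_W f'_W(empty).  A play is won once its rounded image c
is nonempty and f c is less than theta plus two thirds of eps.  A position c is
winning below a block subspace X (wins) if the second player can force this
against subspaces of X; the predicate is inductive, because winning plays are
finite.  It only improves when X is shrunk or changed by a finite-dimensional
piece (wins_almost).  As there are finitely many positions below each coordinate,
a fusion argument (fusion) produces an X that decides every position: it is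
winning below X, or winning below no block subspace almost contained in X
(exists_deciding).  If the empty position were lost below X, then every lost
position could only be continued to lost positions inside a suitable subspace,
since otherwise it would be winning; a second fusion gives a block subspace Z in
which every block sequence leads to a lost position.  But the definition of theta
supplies a block sequence of Z at which f is less than theta plus a third of eps,
and its rounded image is won: a contradiction (exists_winning).

Hence the empty position is winning below some V, and induction on the winning
predicate assembles the strategy (wins_strategy). *)

(** * Linear spans *)

Section Spans.
Variables (K : numFieldType) (E : lmodType K).
Implicit Types (A B : set E).

Lemma lin_span0 A : lin_span A 0.
Proof. by exists 0%N, (fun=> 0), (fun=> 0); split=> [[]|]; rewrite ?big_ord0. Qed.

Lemma lin_span_cons A a w x : A w -> lin_span A x -> lin_span A (a *: w + x).
Proof.
move=> Aw [n [c [v [Av ->]]]].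
exists n.+1, (fun i => if unlift ord0 i is Some j then c j else a),
  (fun i => if unlift ord0 i is Some j then v j else w); split.
  by move=> i; case: unliftP => [j|] _.
rewrite big_ord_recl unlift_none; congr (_ + _).
by apply: eq_bigr => i _; rewrite liftK.
Qed.

Lemma lin_span_ind A (P : E -> Prop) :
  P 0 -> (forall a w x, A w -> P x -> P (a *: w + x)) ->
  forall x, lin_span A x -> P x.
Proof.
move=> P0 PS x [n [c [w [Aw ->]]]].
elim: n c w Aw => [|n IHn] c w Aw; first by rewrite big_ord0.
by rewrite big_ord_recl; apply: PS => //; apply: IHn.
Qed.

Lemma lin_spanZD A a x y :
  lin_span A x -> lin_span A y -> lin_span A (a *: x + y).
Proof.
move=> Ax Ay; elim/lin_span_ind: Ax => [|b w z Aw IH].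
  by rewrite scaler0 add0r.
by rewrite scalerDr scalerA -addrA; apply: lin_span_cons.
Qed.

Lemma sub_lin_span A x : A x -> lin_span A x.
Proof.
by move=> Ax; rewrite -[x]addr0 -[x]scale1r; apply: lin_span_cons => //; apply: lin_span0.
Qed.

Lemma lin_spanZ A a x : lin_span A x -> lin_span A (a *: x).
Proof. by move=> Ax; rewrite -[_ *: _]addr0; apply: lin_spanZD => //; apply: lin_span0. Qed.

Lemma lin_span_sub A B : A `<=` lin_span B -> lin_span A `<=` lin_span B.
Proof.
move=> AB x; elim/lin_span_ind => [|a w y /AB Bw By]; first exact: lin_span0.
exact: lin_spanZD.
Qed.

Lemma lin_span_mono A B : A `<=` B -> lin_span A `<=` lin_span B.
Proof. by move=> AB; apply: lin_span_sub => x /AB; apply: sub_lin_span. Qed.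

Lemma lin_span_sum A n (c : nat -> K) (w : nat -> E) :
  (forall i, c i != 0 -> A (w i)) -> lin_span A (\sum_(i < n) c i *: w i).
Proof.
move=> cA; elim: n => [|n IHn]; first by rewrite big_ord0; apply: lin_span0.
rewrite big_ord_recr /= addrC; have [->|/cA ?] := eqVneq (c n) 0.
  by rewrite scale0r add0r.
exact: lin_span_cons.
Qed.

(** Families of vectors of the range may repeat an index; collecting equal indices
gives one coefficient per index, which is what coordinate computations need. *)
Lemma lin_span_rangeP (v : nat -> E) x :
  lin_span (range v) x <->
  exists n (c : nat -> K), x = \sum_(i < n) c i *: v i.
Proof.
split=> [|[n [c ->]]]; last by apply: lin_span_sum => i _; exists i.
elim/lin_span_ind => [|a _ y [k _ <-] [n [c ->]]].
  by exists 0%N, (fun=> 0); rewrite big_ord0.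
exists (maxn n k.+1),
  (fun i => (if i == k then a else 0) + (if (i < n)%N then c i else 0)).
under [RHS]eq_bigr do rewrite scalerDl.
rewrite big_split /=; congr (_ + _).
  rewrite (bigD1 (Ordinal (leq_maxr n k.+1))) //= eqxx big1 ?addr0 // => i.
  by rewrite -val_eqE /= => /negbTE ->; rewrite scale0r.
rewrite (big_ord_widen _ (fun i => c i *: v i) (leq_maxl n k.+1)).
by rewrite big_mkcond /=; apply: eq_bigr => i _; case: ifP; rewrite ?scale0r.
Qed.

End Spans.

(** * Coordinates, supports and block sequences *)

Section Coordinates.
Variables (K : numFieldType) (E : lmodType K) (e : nat -> E).
Hypothesis he : hamel_basis e.
Implicit Types (x y : E) (s u v : seq E) (V W X Y Z : set E).

Definition coef x (j : nat) : K := (coords e x)`_j.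

Lemma coords_sum x : x = \sum_(j < size (coords e x)) (coords e x)`_j *: e j.
Proof.
rewrite /coords; case: xgetP => [a -> //|no]; exfalso.
have : lin_span (range e) x by rewrite he.2.
move=> /lin_span_rangeP[n [c xE]]; apply: (no (mkseq c n)).
by rewrite /= size_mkseq xE; apply: eq_bigr => i _; rewrite nth_mkseq.
Qed.

Lemma coef_ge_size x j : (size (coords e x) <= j)%N -> coef x j = 0.
Proof. exact: nth_default. Qed.

Lemma sum_widen n m (c : nat -> K) : (n <= m)%N -> (forall j, (n <= j)%N -> c j = 0) ->
  \sum_(j < n) c j *: e j = \sum_(j < m) c j *: e j.
Proof.
move=> nm c0; rewrite (big_ord_widen _ (fun i => c i *: e i) nm) big_mkcond /=.
by apply: eq_bigr => i _; case: ltnP => // /c0 ->; rewrite scale0r.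
Qed.

Lemma coef_sum x n : (size (coords e x) <= n)%N -> x = \sum_(j < n) coef x j *: e j.
Proof. by move=> sn; rewrite {1}[x]coords_sum (sum_widen sn) //; apply: coef_ge_size. Qed.

Lemma coef_uniq x n (c : nat -> K) : x = \sum_(j < n) c j *: e j ->
  (forall j, (n <= j)%N -> c j = 0) -> coef x =1 c.
Proof.
move=> xE c0 j; pose N := maxn (maxn n j.+1) (size (coords e x)).
have nN : (n <= N)%N by rewrite /N !leq_max leqnn.
have jN : (j < N)%N by rewrite /N !leq_max leqnn orbT.
have sN : (size (coords e x) <= N)%N by rewrite /N leq_maxr.
have : \sum_(i < N) (coef x i - c i) *: e i = 0.
  under eq_bigr do rewrite scalerBl.
  by rewrite sumrB -coef_sum // -(sum_widen nN c0) -xE subrr.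
by move/(he.1 N (fun i => coef x i - c i))/(_ (Ordinal jN)) => /= /eqP; rewrite subr_eq0 => /eqP.
Qed.

Lemma coefD x y j : coef (x + y) j = coef x j + coef y j.
Proof.
pose N := maxn (size (coords e x)) (size (coords e y)).
apply: (@coef_uniq _ N (fun j => coef x j + coef y j)).
  under [RHS]eq_bigr do rewrite scalerDl.
  by rewrite big_split -!coef_sum // leq_max leqnn ?orbT.
by move=> i; rewrite geq_max => /andP[? ?]; rewrite !coef_ge_size ?addr0.
Qed.

Lemma coefZ a x j : coef (a *: x) j = a * coef x j.
Proof.
apply: (@coef_uniq _ (size (coords e x)) (fun j => a * coef x j)).
  under [RHS]eq_bigr do rewrite -scalerA.
  by rewrite -scaler_sumr -coef_sum.
by move=> i ?; rewrite !coef_ge_size ?mulr0.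
Qed.

Lemma coef0 j : coef 0 j = 0.
Proof. by rewrite -(scale0r 0) coefZ mul0r. Qed.

Lemma coefB x y j : coef (x - y) j = coef x j - coef y j.
Proof. by rewrite -scaleN1r coefD coefZ mulN1r. Qed.

Lemma coef_e i j : coef (e i) j = (j == i)%:R.
Proof.
apply: (@coef_uniq _ i.+1 (fun j => (j == i)%:R)).
  rewrite big_ord_recr /= eqxx scale1r big1 ?add0r // => k _.
  by rewrite ltn_eqF ?scale0r.
by move=> k ik; rewrite gtn_eqF.
Qed.

Lemma coef_big n (c : nat -> K) (w : nat -> E) j :
  coef (\sum_(i < n) c i *: w i) j = \sum_(i < n) c i * coef (w i) j.
Proof.
elim: n => [|n IHn]; first by rewrite !big_ord0 coef0.
by rewrite !big_ord_recr /= coefD coefZ IHn.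
Qed.

Lemma coef_eq0 x : coef x =1 (fun=> 0) -> x = 0.
Proof. by move=> x0; rewrite [x](coef_sum (leqnn _)) big1 // => j _; rewrite x0 scale0r. Qed.

(** The support of x <> 0 starts at supp_start x and ends just before supp_end x; the
convention supp_end 0 = 0 lets the zero vector stand for the empty position. *)
Definition supp_start x : nat := find (fun a => a != 0) (coords e x).
Definition supp_end x : nat := \max_(j < size (coords e x) | coef x j != 0) j.+1.

Lemma supp_start_le x j : coef x j != 0 -> (supp_start x <= j)%N.
Proof.
by move=> xj; rewrite leqNgt; apply/negP => /(before_find 0) /negbT; rewrite xj.
Qed.

Lemma lt_supp_end x j : coef x j != 0 -> (j < supp_end x)%N.
Proof.
move=> xj; have js : (j < size (coords e x))%N.
  by rewrite ltnNge; apply: contra xj => /coef_ge_size ->.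
exact: (@leq_bigmax_cond _ _ (fun i : 'I__ => i.+1) (Ordinal js)).
Qed.

Lemma coef_supp_start x : x != 0 -> coef x (supp_start x) != 0.
Proof.
move=> x0; rewrite /coef; apply: (@nth_find _ _ (fun a => a != 0)).
apply: contraNT x0 => /hasPn no; apply/eqP/coef_eq0 => j.
have [/(mem_nth 0)/no|/coef_ge_size//] := ltnP j (size (coords e x)).
by move=> cj; apply/eqP; rewrite -[_ == 0]negbK.
Qed.

Lemma coef_supp_end x : x != 0 -> (0 < supp_end x)%N /\ coef x (supp_end x).-1 != 0.
Proof.
move=> x0; have := coef_supp_start x0 => xs.
have js : (supp_start x < size (coords e x))%N.
  by rewrite ltnNge; apply: contra xs => /coef_ge_size ->.
rewrite /supp_end (bigop.bigmax_eq_arg (Ordinal js)) //=.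
by case: arg_maxnP => //= i.
Qed.

Lemma supp_start_lt_end x : x != 0 -> (supp_start x < supp_end x)%N.
Proof. by move=> /coef_supp_start/lt_supp_end. Qed.

Lemma supp_end0 : supp_end 0 = 0%N.
Proof. by rewrite /supp_end big1 // => j; rewrite coef0 eqxx. Qed.

Lemma coef_lt_supp_start x j : (j < supp_start x)%N -> coef x j = 0.
Proof. by move=> js; apply: contraTeq js => /supp_start_le; rewrite -leqNgt. Qed.

Lemma coef_ge_supp_end x j : (supp_end x <= j)%N -> coef x j = 0.
Proof. by move=> js; apply: contraTeq js => /lt_supp_end; rewrite -ltnNge. Qed.

Lemma supp_start_ge x m : x != 0 -> (forall j, (j < m)%N -> coef x j = 0) -> (m <= supp_start x)%N.
Proof.
by move=> /coef_supp_start xs xm; rewrite leqNgt; apply/negP => /xm x0; rewrite x0 eqxx in xs.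
Qed.

Lemma supp_end_le x m : (forall j, (m <= j)%N -> coef x j = 0) -> (supp_end x <= m)%N.
Proof.
move=> xm; have [->|x0] := eqVneq x 0; first by rewrite supp_end0.
have [e0 xe] := coef_supp_end x0.
by rewrite leqNgt -(prednK e0) ltnS; apply/negP => /xm x1; rewrite x1 eqxx in xe.
Qed.

Lemma supp_startZ a x : a != 0 -> supp_start (a *: x) = supp_start x.
Proof.
move=> a0; have [->|x0] := eqVneq x 0; first by rewrite scaler0.
have ax0 : a *: x != 0 by rewrite scaler_eq0 negb_or a0.
apply/eqP; rewrite eqn_leq; apply/andP; split.
  by apply: supp_start_le; rewrite coefZ mulf_neq0 ?coef_supp_start.
by apply: supp_start_ge => // j /coef_lt_supp_start; rewrite coefZ => ->; rewrite mulr0.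
Qed.

Lemma supp_endZ a x : a != 0 -> supp_end (a *: x) = supp_end x.
Proof.
move=> a0; have [->|x0] := eqVneq x 0; first by rewrite scaler0.
have ax0 : a *: x != 0 by rewrite scaler_eq0 negb_or a0.
apply/eqP; rewrite eqn_leq; apply/andP; split.
  by apply: supp_end_le => j /coef_ge_supp_end; rewrite coefZ => ->; rewrite mulr0.
by apply: supp_end_le => j /coef_ge_supp_end/eqP; rewrite coefZ mulf_eq0 (negbTE a0) => /eqP.
Qed.

Lemma span_coefP (D : set nat) x :
  lin_span [set e j | j in D] x <-> (forall j, coef x j != 0 -> D j).
Proof.
split=> [|xD].
  elim/lin_span_ind => [j|a _ y [i Di <-] yD j]; first by rewrite coef0 eqxx.
  rewrite coefD coefZ coef_e; have [->//|_] := eqVneq j i.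
  by rewrite mulr0 add0r; apply: yD.
rewrite [x](coef_sum (leqnn _)); apply: lin_span_sum => j /xD; by exists j.
Qed.

Lemma tail_spaceP m x : tail_space e m x <-> (forall j, (j < m)%N -> coef x j = 0).
Proof.
rewrite /tail_space span_coefP; split=> xm j.
  by move=> jm; apply: contraTeq jm => /xm; rewrite -leqNgt.
by move=> xj; rewrite /= leqNgt; apply: contraNN xj => /xm ->.
Qed.

Lemma tail_space_start m x : x != 0 -> tail_space e m x <-> (m <= supp_start x)%N.
Proof.
move=> x0; rewrite tail_spaceP; split=> [|ms j jm]; first exact: supp_start_ge.
by apply: coef_lt_supp_start; apply: leq_trans ms.
Qed.

Lemma in_blockP (p : nat -> nat) k x :
  in_block e p k x <-> [/\ x != 0, (p k <= supp_start x)%N & (supp_end x <= p k.+1)%N].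
Proof.
rewrite /in_block span_coefP; split=> [[x0 xp]|[x0 ps ep]]; split=> //.
- by have /andP[] := xp _ (coef_supp_start x0).
- by have [e0 /xp/andP[_]] := coef_supp_end x0; rewrite (prednK e0).
- by move=> j xj /=; rewrite (leq_trans ps (supp_start_le xj)) (leq_trans (lt_supp_end xj)).
Qed.

Definition before x y : bool := (supp_end x <= supp_start y)%N.

(** The dividing integers p are eliminated: the ends of the supports can always
serve as p, so that being a block basis is a condition on consecutive entries. *)
Lemma inf_block_basisP (v : nat -> E) :
  inf_block_basis e v <-> (forall k, v k != 0) /\ (forall k, before (v k) (v k.+1)).
Proof.
split=> [[p [p0 pS pv]]|[v0 vb]].
  split=> k; first by have /in_blockP[] := pv k.
  have /in_blockP[_ _ ekp] := pv k; have /in_blockP[_ pks _] := pv k.+1.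
  exact: leq_trans pks.
exists (fun k => if k is k'.+1 then supp_end (v k') else 0%N); split=> // [] [|k].
- by rewrite (leq_ltn_trans _ (supp_start_lt_end (v0 0%N))).
- by rewrite (leq_ltn_trans (vb k)) ?supp_start_lt_end.
- by apply/in_blockP.
- by apply/in_blockP; split => //; apply: vb.
Qed.

Lemma fin_block_basisP A s : fin_block_basis e A s <->
  [/\ forall x, x \in s -> A x, forall x, x \in s -> x != 0 & sorted before s].
Proof.
split=> [[[p [p0 pS pv]] sA]|[sA s0 ss]].
  split=> // [x|].
    by move=> /(nthP 0)[k ks <-]; have /in_blockP[] := pv k ks.
  apply/(sortedP 0) => k ks; rewrite /before.
  have /in_blockP[_ _ ekp] := pv k (ltnW ks); have /in_blockP[_ pks _] := pv _ ks.
  exact: leq_trans pks.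
split=> //; exists (fun k => if k is k'.+1 then supp_end s`_k' else 0%N); split=> //.
- move=> [|k] ks; first by rewrite (leq_ltn_trans _ (supp_start_lt_end (s0 _ (mem_nth 0 ks)))).
  by rewrite (leq_ltn_trans ((sortedP 0 ss) k ks)) ?supp_start_lt_end ?s0 ?mem_nth.
- move=> [|k] ks; apply/in_blockP; split => //; rewrite ?s0 ?mem_nth //.
  by have /(sortedP 0)/(_ k ks) := ss.
Qed.

Lemma fin_block0 A : fin_block_basis e A [::].
Proof. by apply/fin_block_basisP. Qed.

Lemma fin_block_sub A B s : A `<=` B -> fin_block_basis e A s -> fin_block_basis e B s.
Proof. by move=> AB [? sA]; split=> // x /sA/AB. Qed.

Definition level s : nat := last 0%N (map supp_end s).

Lemma level_rcons s x : level (rcons s x) = supp_end x.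
Proof. by rewrite /level map_rcons last_rcons. Qed.

Lemma sorted_rcons s x : sorted before (rcons s x) = sorted before s && (level s <= supp_start x)%N.
Proof.
by case: s => [//|y s]; rewrite /= rcons_path /before /level /= -/(before _ _) (last_map supp_end).
Qed.

Lemma fin_block_rcons A s x : (forall y, A y -> y != 0) ->
  fin_block_basis e A (rcons s x) <->
  [/\ fin_block_basis e A s, A x & (level s <= supp_start x)%N].
Proof.
move=> A0; rewrite fin_block_basisP sorted_rcons; split.
  move=> [sA s0 /andP[ss sx]]; split=> //; last by apply: sA; rewrite mem_rcons mem_head.
  apply/fin_block_basisP.
  by split=> // y ys; [apply: sA|apply: s0]; rewrite mem_rcons inE ys orbT.
move=> [/fin_block_basisP[sA s0 ss] Ax sx]; rewrite ss sx.
split=> // y; rewrite mem_rcons inE => /predU1P[->//|].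
- exact: sA.
- exact: A0.
- exact: s0.
Qed.

Lemma size_le_level A s : (forall y, A y -> y != 0) -> fin_block_basis e A s -> (size s <= level s)%N.
Proof.
move=> A0; elim/last_ind: s => // s x IH /(fin_block_rcons _ _ A0)[/IH ss Ax sx].
by rewrite size_rcons level_rcons (leq_ltn_trans (leq_trans ss sx)) ?supp_start_lt_end ?A0.
Qed.

(** * The maximum norm *)

(** These three properties determine the norm.  They are proved on the list of
coordinates because the order of the scalars is only partial, whereas the values
compared by the maximum are real. *)
Lemma max_normP x : [/\ 0 <= max_norm e x, forall j, `|coef x j| <= max_norm e x &
  max_norm e x = 0 \/ exists j, max_norm e x = `|coef x j|].
Proof.
rewrite /max_norm /coef; elim: (coords e x) => [|a s [M0 sM Ms]].
  by rewrite big_nil; split=> // [j|]; [rewrite nth_nil normr0|left].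
rewrite big_cons; set M := \big[_/_]_(_ <- _) _ in M0 sM Ms *.
have cmp : (`|a| >=< M)%O by rewrite real_comparable ?ger0_real.
have [aM|Ma] := comparable_leP cmp.
  split=> // [[//|j]|]; first exact: sM.
  by case: Ms => [->|[j ->]]; [left|right; exists j.+1].
split; [exact: normr_ge0|case=> [|j]|by right; exists 0%N] => //=.
exact: le_trans (sM j) (ltW Ma).
Qed.

Lemma max_norm_ge0 x : 0 <= max_norm e x. Proof. by case: (max_normP x). Qed.
Lemma coef_le_norm x j : `|coef x j| <= max_norm e x. Proof. by case: (max_normP x). Qed.

Lemma max_norm_le x M : 0 <= M -> (forall j, `|coef x j| <= M) -> max_norm e x <= M.
Proof. by move=> M0 xM; case: (max_normP x) => _ _ [->|[j ->]]. Qed.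

Lemma max_normZ a x : max_norm e (a *: x) = `|a| * max_norm e x.
Proof.
have h b y : max_norm e (b *: y) <= `|b| * max_norm e y.
  apply: max_norm_le => [|j]; first by rewrite mulr_ge0 ?max_norm_ge0.
  by rewrite coefZ normrM ler_wpM2l ?coef_le_norm.
apply/eqP; rewrite eq_le h /=; have [->|a0] := eqVneq a 0.
  by rewrite normr0 mul0r max_norm_ge0.
have na : 0 < `|a| by rewrite normr_gt0.
by rewrite -ler_pdivlMl // -normfV -{1}[x](scalerK a0) h.
Qed.

Lemma max_norm_gt0 x : (0 < max_norm e x) = (x != 0).
Proof.
apply/idP/idP => [|x0]; first by apply: contraTneq => ->; rewrite -(scale0r (0 : E)) max_normZ normr0 mul0r ltxx.
by apply: lt_le_trans (coef_le_norm x (supp_start x)); rewrite normr_gt0 coef_supp_start.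
Qed.

Lemma A_inftyP x : A_infty e x <-> x != 0 /\ max_norm e x <= 1.
Proof. by rewrite /A_infty /= -max_norm_gt0; split=> [/andP[]|[-> ->]]. Qed.

Lemma A_infty_neq0 x : A_infty e x -> x != 0.
Proof. by move=> /A_inftyP[]. Qed.

Lemma S_infty_A x : S_infty e x -> A_infty e x.
Proof. by rewrite /S_infty /A_infty /= => ->; rewrite ltr01 lexx. Qed.

Definition dir x : E := (max_norm e x)^-1 *: x.

Lemma dirK x : x != 0 -> max_norm e x *: dir x = x.
Proof. by rewrite -max_norm_gt0 => x0; rewrite /dir scalerA mulfV ?scale1r ?gt_eqF. Qed.

Lemma dir_S x : x != 0 -> S_infty e (dir x).
Proof.
rewrite -max_norm_gt0 => x0; rewrite /S_infty /dir /= max_normZ ger0_norm ?mulVf ?gt_eqF //.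
by rewrite invr_ge0 ltW.
Qed.

Lemma supp_start_dir x : x != 0 -> supp_start (dir x) = supp_start x.
Proof. by rewrite -max_norm_gt0 => x0; rewrite supp_startZ // invr_eq0 gt_eqF. Qed.
Lemma supp_end_dir x : x != 0 -> supp_end (dir x) = supp_end x.
Proof. by rewrite -max_norm_gt0 => x0; rewrite supp_endZ // invr_eq0 gt_eqF. Qed.

Lemma scale_S_A a x : S_infty e x -> 0 < a <= 1 -> A_infty e (a *: x).
Proof.
move=> x1 /andP[a0 a1]; rewrite /A_infty /= max_normZ x1 mulr1 gtr0_norm //.
by rewrite a0 a1.
Qed.

(** * Block subspaces *)

Lemma block_full : block_subspaces e [set: E].
Proof.
exists e; last by rewrite he.2.
apply/inf_block_basisP; have e0 k : e k != 0.
  by apply/eqP => ek; have := coef_e k k; rewrite ek coef0 eqxx => /eqP; rewrite eq_sym oner_eq0.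
have es k : supp_start (e k) = k.
  by apply/eqP; have := coef_supp_start (e0 k); rewrite coef_e pnatr_eq0 eqb0 negbK.
split=> // k; rewrite /before es; apply: supp_end_le => j kj.
by rewrite coef_e gtn_eqF.
Qed.

Lemma block_start_ge (v : nat -> E) k : inf_block_basis e v -> (k <= supp_start (v k))%N.
Proof.
move=> /inf_block_basisP[v0 vb]; elim: k => // k IH.
exact: leq_ltn_trans IH (leq_trans (supp_start_lt_end (v0 k)) (vb k)).
Qed.

(** Dropping the first m blocks suffices, as the k-th block starts at coordinate k
or later. *)
Lemma block_tail W m : block_subspaces e W ->
  exists Y, [/\ block_subspaces e Y, Y `<=` W & Y `<=` tail_space e m].
Proof.
move=> [v vb ->]; exists (lin_span (range (fun k => v (k + m)%N))).
have /inf_block_basisP[v0 vS] := vb; split.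
- by exists (fun k => v (k + m)%N) => //; apply/inf_block_basisP; split=> k; rewrite ?addSn.
- by apply: lin_span_mono => _ [k _ <-]; exists (k + m)%N.
- apply: lin_span_sub => _ [k _ <-]; apply/(tail_space_start _ (v0 _)).
  exact: leq_trans (leq_addl k m) (block_start_ge (k + m) vb).
Qed.

Lemma block_vec W m : block_subspaces e W -> exists2 x, W x & x != 0 /\ (m <= supp_start x)%N.
Proof.
move=> [v vb ->]; have /inf_block_basisP[v0 _] := vb.
by exists (v m); [apply: sub_lin_span; exists m|split; rewrite ?block_start_ge].
Qed.

Lemma block_span W : block_subspaces e W -> exists A, W = lin_span A.
Proof. by move=> [v _ ->]; exists (range v). Qed.

Lemma blockZ W a x : block_subspaces e W -> W x -> W (a *: x).
Proof. by move=> /block_span[A ->]; apply: lin_spanZ. Qed.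

Lemma block_vecA W m : block_subspaces e W -> exists2 x, W x & A_infty e x /\ (m <= supp_start x)%N.
Proof.
move=> BW; have [x Wx [x0 mx]] := block_vec m BW.
exists (dir x); first exact: blockZ.
by split; [apply/S_infty_A/dir_S|rewrite supp_start_dir].
Qed.

End Coordinates.

(** * Finite nets *)

(** Total boundedness of the closed unit ball of the scalars: the one property of R
and R[i] on which the compactness arguments below rest. *)
Definition bounded_nets (K : numFieldType) : Prop := forall d : K, 0 < d ->
  exists s : seq K, forall x : K, `|x| <= 1 -> exists2 y, y \in s & `|x - y| <= d.

Lemma bounded_nets_real (R : realType) : bounded_nets R.
Proof.
move=> d d0.
have pos n : exists s : seq R, forall x, 0 <= x <= n%:R * d -> exists2 y, y \in s & `|x - y| <= d.
  elim: n => [|n [s sP]].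
    by exists [:: 0] => x; rewrite mul0r => /le_anti <-; exists 0; rewrite ?mem_head ?subrr ?normr0 ?ltW.
  exists ((n.+1%:R * d) :: s) => x /andP[x0 xn].
  have [xn'|nx] := leP x (n%:R * d).
    by have [|y ys xy] := sP x; [rewrite x0|exists y; rewrite // inE ys orbT].
  exists (n.+1%:R * d); rewrite ?mem_head // distrC ger0_norm ?subr_ge0 //.
  by rewrite lerBlDr addrC -lerBlDr (le_trans _ (ltW nx)) // -natr1 mulrDl mul1r addrK.
have [n nd] : exists n : nat, d^-1 <= n%:R.
  by exists (Num.truncn d^-1).+1; rewrite ltW // truncnS_gt.
have [s sP] := pos n; exists (s ++ map -%R s) => x x1.
have [] := sP `|x|.
  by rewrite normr_ge0 /= (le_trans x1) // -ler_pdivrMr // mul1r.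
move=> y ys; have [x0|x0] := ger0P x.
  by exists y; rewrite // mem_cat ys.
exists (- y); first by rewrite mem_cat map_f ?orbT.
by rewrite -normrN opprB addrC.
Qed.

Lemma bounded_nets_complex (R : realType) : bounded_nets R[i].
Proof.
move=> d d0; have dE : d = (complex.Re d)%:C%C by rewrite RRe_real // gtr0_real.
set r := complex.Re d in dE; have r0 : 0 < r by rewrite -ltcR -dE.
have [s sP] := bounded_nets_real (divr_gt0 r0 (ltr0n _ 2)).
exists [seq (a +i* b)%C | a <- s, b <- s] => -[x y] xy.
have part_le (z : R[i]) : `|z| <= 1 -> `|complex.Re z| <= 1 /\ `|complex.Im z| <= 1.
  rewrite normc_def (_ : 1 = 1%:C%C) // lecR => z1.
  by split; apply: le_trans z1; rewrite -sqrtr_sqr ler_wsqrtr // ?lerDl ?lerDr sqr_ge0.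
have [/= /sP[a sa xa] /sP[b sb yb]] := part_le _ xy.
exists (a +i* b)%C; first exact: allpairs_f.
rewrite normc_def dE lecR /= -[leRHS](ger0_norm (ltW r0)) -sqrtr_sqr ler_wsqrtr //.
have sq (t : R) : `|t| <= r / 2 -> t ^+ 2 <= (r / 2) ^+ 2.
  by move=> tr; rewrite -real_normK ?num_real // ler_pXn2r // nnegrE // divr_ge0 // ltW.
have := lerD (sq _ xa) (sq _ yb); move/le_trans; apply.
by rewrite expr_div_n; nra.
Qed.

(** The centres of a net can be moved into the set S: a centre near some point of S
is replaced by such a point, at the price of comparing points of S with each
other through the old centre. *)
Lemma net_inside (T C : choiceType) (S : set T) (near : C -> T -> Prop) (l : seq C) :
  exists2 l' : seq T, (forall v, v \in l' -> S v) &
    forall x y, S x -> y \in l -> near y x -> exists2 v, v \in l' & near y v.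
Proof.
elim: l => [|z l [l' l'S IH]]; first by exists [::].
have [[v [Sv zv]]|no] := pselect (exists v, S v /\ near z v).
  exists (v :: l') => [w /predU1P[->//|/l'S//]|x y Sx].
  move=> /predU1P[->|yl] yx; first by exists v; rewrite ?mem_head.
  by have [w wl' yw] := IH x y Sx yl yx; exists w; rewrite // inE wl' orbT.
exists l' => // x y Sx /predU1P[-> zx|]; last exact: IH.
by case: no; exists x.
Qed.

Section Nets.
Variables (K : numFieldType) (E : lmodType K) (e : nat -> E).
Hypothesis he : hamel_basis e.
Hypothesis hK : bounded_nets K.
Implicit Types (x y : E).

(** On each span of finitely many basis vectors, the finest vector topology is the
topology of coordinates, so a neighbourhood of 0 contains a small box there. *)
Lemma T_nbhs0_box U N : T_nbhs0 U -> exists2 d : K, 0 < d &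
  forall x, (supp_end e x <= N)%N -> (forall j, `|coef e x j| <= d) -> U x.
Proof.
move=> [G [Go G0 GU]].
have /(_ (he.1 N)) := Go N (fun i : 'I_N => e i).
rewrite openE => /(_ 0); rewrite /interior /=.
have s0 : G (\sum_(i < N) (0 : 'rV[K]_N) ord0 i *: e i).
  by rewrite big1 // => i _; rewrite mxE scale0r.
move=> /(_ s0) /nbhs_ballP[d /= d0 dG].
exists (d / 2) => [|x xN xd]; first exact: divr_gt0.
apply: GU; have -> : x = \sum_(i < N) (\row_(i < N) coef e x i) ord0 i *: e i.
  pose M := maxn N (size (coords e x)).
  rewrite {1}[x](@coef_sum _ _ _ he _ M) ?leq_maxr // -(sum_widen e (leq_maxl _ _)).
    by apply: eq_bigr => i _; rewrite mxE.
  by move=> j Nj; rewrite coef_ge_supp_end // (leq_trans xN).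
apply: dG; split=> // i j; rewrite !mxE /ball /= sub0r normrN.
by apply: le_lt_trans (xd j) _; rewrite ltr_pdivrMr // ltr_pMr // ltr1n.
Qed.

(** One coordinate at a time: a net for N.+1 coordinates is the product of a net
for N coordinates and a net of scalars. *)
Lemma box_net N (d : K) : 0 < d -> exists l : seq E,
  forall x, (supp_end e x <= N)%N -> (forall j, `|coef e x j| <= 1) ->
    exists2 y, y \in l & (supp_end e y <= N)%N /\ forall j, `|coef e x j - coef e y j| <= d.
Proof.
move=> d0; have [s sP] := hK d0; elim: N => [|N [l lP]].
  exists [:: 0] => x x0 _; exists 0; first exact: mem_head.
  split=> [|j]; first by rewrite supp_end0.
  by rewrite coef_ge_supp_end ?(leq_trans x0) // coef0 // subrr normr0 ltW.
exists [seq c *: e N + y | c <- s, y <- l] => x xN x1.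
have [c cs xc] := sP _ (x1 N).
have zE j : coef e (x - coef e x N *: e N) j = if j == N then 0 else coef e x j.
  rewrite coefB // coefZ // coef_e //; case: eqVneq => [->|_]; first by rewrite mulr1 subrr.
  by rewrite mulr0 subr0.
have [||y yl [yN xy]] := lP (x - coef e x N *: e N).
- apply: supp_end_le => // j; rewrite leq_eqVlt zE => /predU1P[<-|Nj]; first by rewrite eqxx.
  by case: eqP => // _; rewrite coef_ge_supp_end // (leq_trans xN).
- by move=> j; rewrite zE; case: ifP; rewrite ?normr0.
exists (c *: e N + y); first exact: allpairs_f.
have yE j : coef e (c *: e N + y) j = if j == N then c else coef e y j.
  rewrite coefD // coefZ // coef_e //; case: eqVneq => [->|_].
    by rewrite mulr1 coef_ge_supp_end ?addr0.
  by rewrite mulr0 add0r.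
split=> [|j].
  apply: supp_end_le => // j Nj; rewrite yE gtn_eqF // coef_ge_supp_end //.
  exact: leq_trans yN (ltnW Nj).
by rewrite yE; case: eqVneq (xy j) (zE j) => [->//|jN xyj <-].
Qed.

(** The two ends of the support are prescribed, so that replacing an entry of a
block sequence by another point of the same part gives a block sequence. *)
Definition sphere_part a b : set E :=
  [set v | [/\ S_infty e v, supp_start e v = a & supp_end e v = b]].

Lemma sphere_net U a b : T_nbhs0 U -> exists2 l : seq E,
  (forall v, v \in l -> sphere_part a b v) &
  forall x, sphere_part a b x -> exists2 v, v \in l & U (x - v).
Proof.
move=> /(T_nbhs0_box b)[d d0 dU].
have [l lP] := box_net b (divr_gt0 d0 (ltr0n _ 2)).
pose near y x := forall j, `|coef e x j - coef e y j| <= d / 2.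
have [l' l'S l'P] := net_inside (sphere_part a b) near l.
exists l' => // x Sx; have [x1 xa xb] := Sx.
have [||y yl [_ xy]] := lP x; first by rewrite xb.
  by move=> j; rewrite -x1 coef_le_norm.
have [v vl' yv] := l'P x y Sx yl xy; exists v => //.
have [_ _ vb] := l'S v vl'; apply: dU => [|j].
  by apply: supp_end_le => // j bj; rewrite coefB // !coef_ge_supp_end ?subrr ?xb ?vb.
rewrite coefB // -(subrKA (coef e y j)) (le_trans (ler_normD _ _)) //.
by rewrite [leRHS](splitr d) lerD // distrC.
Qed.

Lemma scalar_net (d : K) : 0 < d -> exists2 l : seq K,
  (forall m, m \in l -> 0 < m <= 1) &
  forall x : K, 0 < x <= 1 -> exists2 m, m \in l & `|x - m| <= d.
Proof.
move=> d0; have [s sP] := hK (divr_gt0 d0 (ltr0n _ 2)).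
pose near (y x : K) := `|x - y| <= d / 2.
have [l lS lP] := net_inside [set x : K | 0 < x <= 1] near s.
exists l => // x x01; have [|y ys xy] := sP x.
  by case/andP: x01 => x0 x1; rewrite gtr0_norm.
have [m ml ym] := lP x y x01 ys xy; exists m => //.
rewrite -(subrKA y) (le_trans (ler_normD _ _)) //.
by rewrite [leRHS](splitr d) lerD // distrC.
Qed.

End Nets.

(** * Fusion of block subspaces *)

Section Fusion.
Variables (K : numFieldType) (E : lmodType K) (e : nat -> E).
Hypothesis he : hamel_basis e.
Implicit Types (V W X Y Z : set E) (w : nat -> E).

(** A combination of blocks that vanishes on the first m coordinates uses no block
starting there: at its first coordinate a block is alone, so its coefficient can
be read off. *)
Lemma span_tail w m x : inf_block_basis e w -> lin_span (range w) x ->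
  tail_space e m x -> lin_span [set w k | k in [set k | (m <= supp_start e (w k))%N]] x.
Proof.
move=> wb /lin_span_rangeP[n [c ->]] /(tail_spaceP he) xm.
have /(inf_block_basisP he)[w0 wS] := wb.
have mono i j : (i < j)%N -> (supp_end e (w i) <= supp_start e (w j))%N.
  elim: j => // j IH; rewrite ltnS leq_eqVlt => /predU1P[->|/IH ij]; first exact: wS.
  exact: leq_trans ij (leq_trans (ltnW (supp_start_lt_end he (w0 j))) (wS j)).
pose c' i := if (i < n)%N then c i else 0.
have -> : \sum_(i < n) c i *: w i = \sum_(i < n) c' i *: w i.
  by apply: eq_bigr => i _; rewrite /c' ltn_ord.
apply: lin_span_sum => k; rewrite /c'; case: ifP => [kn ck|]; last by rewrite eqxx.
exists k => //=; rewrite leqNgt; apply: contraNN ck => /xm.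
rewrite coef_big // (bigD1 (Ordinal kn)) //= big1 ?addr0.
  by move=> /eqP; rewrite mulf_eq0 (negbTE (coef_supp_start he (w0 k))) orbF.
move=> i; rewrite -val_eqE /= neq_ltn => /orP[ik|ki].
  by rewrite coef_ge_supp_end ?mulr0 // mono.
by rewrite coef_lt_supp_start ?mulr0 // (leq_trans (supp_start_lt_end he (w0 k))) ?mono.
Qed.

(** The last block with a nonzero coefficient determines the end of the support. *)
Lemma span_supp_end w x : inf_block_basis e w -> lin_span (range w) x -> x != 0 ->
  exists k, supp_end e x = supp_end e (w k).
Proof.
move=> /(inf_block_basisP he)[w0 wS] /lin_span_rangeP[n [c ->]].
have mono i j : (i < j)%N -> (supp_end e (w i) < supp_end e (w j))%N.
  elim: j => // j IH; rewrite ltnS leq_eqVlt => /predU1P[->|/IH ij].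
    exact: leq_ltn_trans (wS j) (supp_start_lt_end he (w0 _)).
  exact: leq_trans ij (leq_trans (wS j) (ltnW (supp_start_lt_end he (w0 _)))).
elim: n => [|n IH]; first by rewrite big_ord0 eqxx.
have [c0|c0] := eqVneq (c n) 0; first by rewrite big_ord_recr /= c0 scale0r addr0.
move=> _; exists n; have [en0 nz] := coef_supp_end he (w0 n).
have hi j : ((supp_end e (w n)).-1 <= j)%N -> coef e (\sum_(i < n) c i *: w i) j = 0.
  move=> nj; rewrite coef_big // big1 // => i _.
  by rewrite coef_ge_supp_end ?mulr0 // (leq_trans _ nj) // -ltnS prednK // mono.
apply/eqP; rewrite eqn_leq; apply/andP; split.
  apply: supp_end_le => // j nj; rewrite big_ord_recr /= coefD // coefZ //.
  by rewrite (coef_ge_supp_end nj) mulr0 addr0 hi // (leq_trans (leq_pred _)).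
rewrite -(prednK en0); apply: lt_supp_end => //.
by rewrite big_ord_recr /= coefD // coefZ // hi // add0r mulf_neq0.
Qed.

(** Blocks are chosen successively: w_k is taken in a subspace Z_k inside Z_(k-1)
that satisfies Q at the level where w_(k-1) ends.  The span X of the blocks works
because a nonzero vector u of X ends where some block w_k ends, and the vectors
of X beyond that level are combinations of the later blocks, all of which lie in
Z_(k+1). *)
Lemma fusion (Q : nat -> set E -> Prop) X0 : block_subspaces e X0 ->
  (forall N Y Z, Z `<=` Y -> Q N Y -> Q N Z) ->
  (forall N Y, block_subspaces e Y -> Y `<=` X0 ->
    exists Z, [/\ block_subspaces e Z, Z `<=` Y & Q N Z]) ->
  exists X, [/\ block_subspaces e X, X `<=` X0 & forall u, X u ->
    exists2 Z, Q (supp_end e u) Z & X `&` tail_space e (supp_end e u) `<=` Z].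
Proof.
move=> BX0 Qsub Qdense.
pose good (p : set E * E) := block_subspaces e p.1 /\ p.1 `<=` X0.
pose next (p q : set E * E) := [/\ good q, q.1 `<=` p.1, Q (supp_end e p.2) q.1,
  q.1 q.2 & q.2 != 0 /\ (supp_end e p.2 <= supp_start e q.2)%N].
have nextP p : exists q, good p -> next p q.
  have [[Bp pX0]|?] := pselect (good p); last by exists p.
  have [Z [BZ Zp QZ]] := Qdense (supp_end e p.2) p.1 Bp pX0.
  have [x Zx x0] := block_vec he (supp_end e p.2) BZ.
  by exists (Z, x) => _; split=> //; split=> // y /Zp/pX0.
have [nx nxP] := choice nextP.
pose P k := iter k nx (X0, 0).
have gP k : good (P k).
  by elim: k => [|k /nxP[]//]; split.
have nP k : next (P k) (P k.+1) by apply: nxP.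
pose w k := (P k.+1).2.
have wb : inf_block_basis e w.
  apply/(inf_block_basisP he); split=> k; first by have [_ _ _ _ []] := nP k.
  by have [_ _ _ _ []] := nP k.+1.
have /(inf_block_basisP he)[w0 wS] := wb.
have dec k j : (k <= j)%N -> (P j).1 `<=` (P k).1.
  elim: j => [|j IH]; first by rewrite leqn0 => /eqP->.
  rewrite leq_eqVlt => /predU1P[->//|/IH jk]; have [_ sub _ _ _] := nP j.
  exact: subset_trans sub jk.
have wP k j : (k <= j.+1)%N -> (P k).1 (w j).
  by move=> kj; apply: (dec _ _ kj); have [] := nP j.
have spanP k : block_subspaces e (P k).1 ->
  forall D, (forall i, D i -> (P k).1 (w i)) -> lin_span [set w i | i in D] `<=` (P k).1.
  move=> /block_span[A ->] D DA; apply: lin_span_sub => _ [i /DA ? <-] //.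
exists (lin_span (range w)); split.
- by exists w.
- by apply: (spanP 0%N BX0 setT) => i _; apply: (wP 0%N).
move=> u uX.
(* The starting pair (X0, 0) has level 0 and takes care of u = 0. *)
have [k uk] : exists k, supp_end e u = supp_end e (P k).2.
  have [->|u0] := eqVneq u 0; first by exists 0%N.
  by have [k ->] := span_supp_end wb uX u0; exists k.+1.
exists (P k.+1).1; first by rewrite uk; have [] := nP k.
move=> x [wx xu]; have := span_tail wb wx xu.
apply: (spanP k.+1); first by have [] := gP k.+1.
move=> i ki; apply: wP; move: ki; rewrite /= uk => ki.
rewrite ltnNge; apply/negP => ik.
case: k ik ki {uk} => // k; rewrite ltnS => ik /= ki.
have := leq_trans ki (ltnW (supp_start_lt_end he (w0 i))).
have mono j : (i <= j)%N -> (supp_end e (w i) <= supp_end e (w j))%N.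
  elim: j => [|j IH]; first by rewrite leqn0 => /eqP->.
  rewrite leq_eqVlt => /predU1P[->//|/IH ij].
  exact: leq_trans ij (leq_trans (wS j) (ltnW (supp_start_lt_end he (w0 _)))).
by move: (leq_trans (supp_start_lt_end he (w0 i)) (mono k ik)); rewrite ltnNge ki.
Qed.
End Fusion.

(** * Rounding block sequences *)

Section Shapes.
Variables (K : numFieldType) (E : lmodType K) (e : nat -> E).
Hypothesis he : hamel_basis e.
Implicit Types (x y : E) (s u v c : seq E).

Definition shape x := (supp_start e x, supp_end e x).

(** Being a block sequence depends only on the supports, hence survives any
modification of the entries that keeps both ends of each support. *)
Lemma fin_block_shape A B s s' : (forall y, B y -> y != 0) ->
  fin_block_basis e A s -> map shape s' = map shape s ->
  (forall x, x \in s' -> B x) -> fin_block_basis e B s'.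
Proof.
move=> B0 /(fin_block_basisP he)[_ _ ss] shE sB; apply/(fin_block_basisP he).
split=> // [x /sB/B0//|].
have sE t : sorted (before e) t = sorted (fun p q => (p.2 <= q.1)%N) (map shape t).
  by rewrite sorted_map.
by rewrite sE shE -sE.
Qed.

Lemma fin_block_prefix A s s' : fin_block_basis e A (s ++ s') -> fin_block_basis e A s.
Proof.
move=> /(fin_block_basisP he)[sA s0 ss]; apply/(fin_block_basisP he); split.
- by move=> x xs; apply: sA; rewrite mem_cat xs.
- by move=> x xs; apply: s0; rewrite mem_cat xs.
- by have [] := cat_sorted2 ss.
Qed.

Lemma level_shape s s' : map shape s' = map shape s -> level e s' = level e s.
Proof.
by move=> /(congr1 (map snd)); rewrite -!map_comp /level => h; congr last.
Qed.

Definition scale (l : seq K) u : seq E := [seq p.1 *: p.2 | p <- zip l u].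

Lemma scale_tupleE r (l : r.-tuple K) (u : r.-tuple E) :
  scale_tuple l u = scale l u :> seq E.
Proof.
apply: (@eq_from_nth _ 0) => [|j]; rewrite size_tuple.
  by rewrite size_map size_zip !size_tuple minnn.
move=> jr; rewrite -[LHS](tnth_nth 0 _ (Ordinal jr)) tnth_mktuple.
rewrite (nth_map (0, 0)) ?size_zip ?size_tuple ?minnn // nth_zip ?size_tuple //=.
by rewrite !(tnth_nth 0).
Qed.

Lemma scale_rcons l a u x : size l = size u ->
  scale (rcons l a) (rcons u x) = rcons (scale l u) (a *: x).
Proof. by move=> lu; rewrite /scale zip_rcons // map_rcons. Qed.

Lemma scale_dir u : (forall x, x \in u -> x != 0) ->
  scale (map (max_norm e) u) (map (dir e) u) = u.
Proof.
elim: u => //= x u IH u0; rewrite /scale /= dirK ?u0 ?mem_head //; congr (_ :: _).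
by apply: IH => y yu; rewrite u0 // inE yu orbT.
Qed.

Lemma map_shape_dir u : (forall x, x \in u -> x != 0) ->
  map shape (map (dir e) u) = map shape u.
Proof.
move=> u0; rewrite -map_comp; apply/eq_in_map => x /u0 x0.
by rewrite /shape /= supp_start_dir // supp_end_dir.
Qed.

Lemma shapeZ a x : a != 0 -> shape (a *: x) = shape x.
Proof. by move=> a0; rewrite /shape supp_startZ // supp_endZ. Qed.

Variables (R : realType) (f : seq E -> R).
Hypothesis hf : admissible e f.

Lemma admissible_near (eps : R) : 0 < eps ->
  exists2 U : nat -> set E, (forall n, T_nbhs0 (U n)) &
    forall (l : seq K) u v, size l = size u -> size v = size u ->
      fin_block_basis e (S_infty e) u -> fin_block_basis e (S_infty e) v ->
      (forall j, (j < size u)%N -> U j (u`_j - v`_j)) ->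
      (forall a, a \in l -> 0 < a <= 1) ->
      `|f (scale l u) - f (scale l v)| < eps.
Proof.
case: hf => _ _ h _ /h[U U0 Uf]; exists U => // l u v lu vu ub vb uv l1.
pose lt := Tuple (introT eqP lu); pose vt := Tuple (introT eqP vu).
have := Uf _ (in_tuple u) vt ub vb; rewrite -(scale_tupleE lt (in_tuple u)) -(scale_tupleE lt vt).
apply=> j; first by rewrite !(tnth_nth 0) /=; apply: uv.
by apply: l1; exact: (mem_tnth j lt).
Qed.

(** The second continuity condition with only the last scalar moving.  The entries
before x keep their own norms as scalars, which turns the condition into one on
sequences c whose normalisation is u. *)
Lemma admissible_scale (eps : R) u x : 0 < eps ->
  fin_block_basis e (S_infty e) (rcons u x) ->
  exists2 d : K, 0 < d & forall c v a b, map (dir e) c = u ->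
    fin_block_basis e (A_infty e) (c ++ x :: v) ->
    0 < a <= 1 -> 0 < b <= 1 -> `|a - b| <= d ->
    `|f (c ++ a *: x :: v) - f (c ++ b *: x :: v)| < eps.
Proof.
case: hf => _ _ _ h eps0 ub; have [d d0 dP] := h _ _ (in_tuple (rcons u x)) eps0 ub.
exists d => // c v a b cu cb a1 b1 ab.
have /(fin_block_basisP he)[cA c0 _] := cb.
have c0' y : y \in c -> y != 0 by move=> yc; apply: c0; rewrite mem_cat yc.
have cA' y : y \in c -> A_infty e y by move=> yc; apply: cA; rewrite mem_cat yc.
have su : size u = size c by rewrite -cu size_map.
have sz t : size (rcons (map (max_norm e) c) t) = size (rcons u x).
  by rewrite !size_rcons size_map su.
pose T t := Tuple (introT eqP (sz t)).
have TE t : scale_tuple (T t) (in_tuple (rcons u x)) = rcons c (t *: x) :> seq E.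
  rewrite scale_tupleE /= scale_rcons ?size_map ?su // -cu scale_dir //.
have T1 t : 0 < t <= 1 -> unit_scalars (T t).
  move=> t1 j; have := mem_tnth j (T t); rewrite /= mem_rcons inE => /predU1P[->//|].
  by move=> /mapP[y /cA' /andP[y0 y1] ->]; rewrite y0 y1.
have := dP (T a) (T b) (T1 a a1) (T1 b b1) _ v.
rewrite !TE !cat_rcons; apply.
  move=> j; rewrite !(tnth_nth 0) /= !nth_rcons; case: ltnP => _; first by rewrite subrr normr0 ltW.
  by case: ifP => // _; rewrite subrr normr0 ltW.
apply: fin_block_shape cb _ _; first by move=> y /A_infty_neq0; apply.
  by rewrite -cu !map_cat /= map_shape_dir.
move=> y; rewrite mem_cat => /orP[|yv]; last by apply: cA; rewrite mem_cat yv orbT.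
by rewrite -cu => /mapP[z /c0' z0 ->]; apply/S_infty_A/dir_S.
Qed.

End Shapes.

Definition round (T : Type) (r : seq T -> T -> T) (u : seq T) : seq T :=
  foldl (fun c y => rcons c (r c y)) [::] u.

Section Rounding.
Variables (K : numFieldType) (E : lmodType K) (e : nat -> E).
Hypotheses (he : hamel_basis e) (hK : bounded_nets K).
Variables (R : realType) (f : seq E -> R).
Hypothesis hf : admissible e f.
Implicit Types (x y : E) (s u v c : seq E).

(** An entry y, of norm a and direction x, is rounded to b *: v, where v is a point
of a net of the sphere near x and b a point of a net of (0,1] near a.  The size
of the first net depends on the index of the entry, that of the second on the
rounded directions so far, because the modulus in the second continuity condition
depends on them.  Half of eta pays for changing all directions at once; the other
half is split geometrically between the successive changes of scalars. *)
Lemma exists_rounding (eta : R) : 0 < eta ->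
  exists r : seq E -> E -> E,
  [/\ forall c y, A_infty e y ->
        [/\ A_infty e (r c y), supp_start e (r c y) = supp_start e y & supp_end e (r c y) = supp_end e y],
      forall c N, exists l : seq E,
        forall y, A_infty e y -> (supp_end e y <= N)%N -> r c y \in l &
      forall u, fin_block_basis e (A_infty e) u -> `|f u - f (round r u)| <= eta].
Proof.
move=> eta0; have h0 : 0 < eta / 2 by rewrite divr_gt0.
have A0 := A_infty_neq0 he.
have S0 y : S_infty e y -> y != 0 by move=> /S_infty_A/A0.
have [U U0 Uf] := admissible_near hf h0.
have /choice[net netP] : forall p : nat * nat * nat, exists l : seq E,
    (forall v : E, v \in l -> sphere_part e p.1.2 p.2 v) /\
    forall x, sphere_part e p.1.2 p.2 x -> exists2 v : E, v \in l & U p.1.1 (x - v).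
  by move=> [[j a] b]; have [l l1 l2] := sphere_net he hK a b (U0 j); exists l.
have /choice[rp rpP] : forall p : nat * E, exists v : E, S_infty e p.2 ->
    v \in net (p.1, supp_start e p.2, supp_end e p.2) /\ U p.1 (p.2 - v).
  move=> [j x]; have [x1|?] := pselect (S_infty e x); last by exists 0.
  by have [_ /(_ x)[//|v]] := netP (j, supp_start e x, supp_end e x); exists v.
pose rep j x := rp (j, x).
have repS j x : S_infty e x -> [/\ S_infty e (rep j x), shape e (rep j x) = shape e x,
    rep j x \in net (j, supp_start e x, supp_end e x) & U j (x - rep j x)].
  move=> x1; have [rn rU] := rpP (j, x) x1; have [/(_ _ rn)[? sa eb] _] := netP (j, supp_start e x, supp_end e x).
  by split=> //; congr pair.
have /choice[dl dlP] : forall u, exists d : K, 0 < d /\ forall w x, u = rcons w x ->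
    fin_block_basis e (S_infty e) (rcons w x) -> forall c v a b, map (dir e) c = w ->
    fin_block_basis e (A_infty e) (c ++ x :: v) ->
    0 < a <= 1 -> 0 < b <= 1 -> `|a - b| <= d ->
    `|f (c ++ a *: x :: v) - f (c ++ b *: x :: v)| < eta / 2 / 2 ^+ size u.
  case/lastP => [|w x]; first by exists 1; split=> // w x /(congr1 size); rewrite size_rcons.
  have [wb|nwb] := pselect (fin_block_basis e (S_infty e) (rcons w x)); last first.
    by exists 1; split=> // w' x' /rcons_inj[<- <-].
  have h1 : 0 < eta / 2 / 2 ^+ size (rcons w x) by rewrite divr_gt0 // exprn_gt0.
  have [d d0 dP] := admissible_scale he hf h1 wb.
  by exists d; split=> // w' x' /rcons_inj[<- <-] _.
have /choice[sc scP] : forall u, exists l : seq K, (forall m, m \in l -> 0 < m <= 1) /\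
    forall x : K, 0 < x <= 1 -> exists2 m, m \in l & `|x - m| <= dl u.
  by move=> u; have [d0 _] := dlP u; have [l l1 l2] := scalar_net hK d0; exists l.
have /choice[mu' muP] : forall p : seq E * K, exists m, 0 < p.2 <= 1 ->
    m \in sc p.1 /\ `|p.2 - m| <= dl p.1.
  move=> [u x]; have [x1|?] := pselect (0 < x <= 1); last by exists 0.
  by have [_ /(_ x x1)[m ms md]] := scP u; exists m.
pose mu u (x : K) := mu' (u, x).
pose vec c y := rep (size c) (dir e y).
pose r c y := mu (rcons (map (dir e) c) (vec c y)) (max_norm e y) *: vec c y.
have vecP c y : A_infty e y -> S_infty e (vec c y) /\ shape e (vec c y) = shape e y.
  move=> /A0 y0; have [vS vsh _ _] := repS (size c) _ (dir_S he y0); split=> //.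
  by rewrite /vec vsh /shape supp_start_dir // supp_end_dir.
have mu1 u (x : K) : 0 < x <= 1 -> [/\ 0 < mu u x <= 1, mu u x \in sc u & `|x - mu u x| <= dl u].
  by move=> x1; have [ms md] := muP (u, x) x1; have [/(_ _ ms)? _] := scP u.
have rP c y : A_infty e y -> A_infty e (r c y) /\ shape e (r c y) = shape e y.
  move=> yA; have [vS vsh] := vecP c y yA.
  have [/andP[m0 m1] _ _] := mu1 (rcons (map (dir e) c) (vec c y)) _ yA; split.
    by apply: scale_S_A => //; rewrite m0.
  by rewrite shapeZ ?gt_eqF.
exists r; split.
- by move=> c y /(rP c)[? [-> ->]].
- move=> c N.
  pose V := flatten [seq net (size c, a, b) | a <- iota 0 N.+1, b <- iota 0 N.+1].
  exists [seq m *: w | w <- V, m <- sc (rcons (map (dir e) c) w)] => y yA yN.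
  have y0 := A0 y yA; have [_ _ vn _] := repS (size c) _ (dir_S he y0).
  have [_ ms _] := mu1 (rcons (map (dir e) c) (vec c y)) _ yA.
  apply: (@allpairs_f_dep _ _ _ (fun w m => m *: w)) => //.
  apply/flattenP; exists (net (size c, supp_start e y, supp_end e y)); last first.
    by rewrite /vec; move: vn; rewrite supp_start_dir // supp_end_dir.
  apply/allpairsP; exists (supp_start e y, supp_end e y); split => //; rewrite mem_iota ltnS /= ?add0n //.
  exact: leq_trans (ltnW (supp_start_lt_end he y0)) yN.
pose fix reps k s : seq E := if s is y :: s' then rep k (dir e y) :: reps k.+1 s' else [::].
(* The directions have been rounded, the scalars not yet. *)
pose half k s := scale (map (max_norm e) s) (reps k s).
have half_cons k y s : half k (y :: s) = max_norm e y *: rep k (dir e y) :: half k.+1 s by [].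
have reps_nth k s j : (j < size s)%N -> (reps k s)`_j = rep (k + j)%N (dir e s`_j).
  elim: s k j => // y s IH k [|j] /=; first by rewrite addn0.
  by rewrite ltnS => /IH ->; rewrite addSnnS.
have size_reps k s : size (reps k s) = size s by elim: s k => //= y s IH k; rewrite IH.
have halfP k s : (forall y, y \in s -> A_infty e y) ->
    (forall y, y \in half k s -> A_infty e y) /\ map (shape e) (half k s) = map (shape e) s.
  elim: s k => // y s IH k sA; have yA := sA y (mem_head _ _); have y0 := A0 y yA.
  have [|hA hs] := IH k.+1; first by move=> z zs; apply: sA; rewrite inE zs orbT.
  have [rS rsh _ _] := repS k _ (dir_S he y0); rewrite half_cons; split.
    by move=> z; rewrite inE => /predU1P[->|/hA//]; apply: scale_S_A => //; have /andP[-> ->] := yA.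
  rewrite /= hs shapeZ // ?rsh; last by rewrite gt_eqF // max_norm_gt0.
  by rewrite /shape supp_start_dir // supp_end_dir.
have tail_bound s c : fin_block_basis e (A_infty e) (c ++ s) ->
    `|f (c ++ half (size c) s) - f (foldl (fun c y => rcons c (r c y)) c s)| <=
    eta / 2 / 2 ^+ size c.
  elim: s c => [|y s IH] c cb.
    by rewrite (_ : half _ [::] = [::]) // cats0 subrr normr0 divr_ge0 ?exprn_ge0 // ltW.
  have /(fin_block_basisP he)[cA _ _] := cb.
  have yA : A_infty e y by apply: cA; rewrite mem_cat mem_head orbT.
  have sA z : z \in s -> A_infty e z by move=> zs; apply: cA; rewrite mem_cat inE zs !orbT.
  have c'A z : z \in c -> A_infty e z by move=> zc; apply: cA; rewrite mem_cat zc.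
  have [vS vsh] := vecP c y yA; have [mA msh] := rP c y yA.
  have [hA hsh] := halfP (size c).+1 s sA.
  have [m1 _ md] := mu1 (rcons (map (dir e) c) (vec c y)) _ yA.
  have [_ /(_ _ _ erefl)] := dlP (rcons (map (dir e) c) (vec c y)).
  have wb : fin_block_basis e (S_infty e) (rcons (map (dir e) c) (vec c y)).
    have := cb; rewrite -cat_rcons => /fin_block_prefix => /(_ he) cyb.
    apply: (fin_block_shape he S0 cyb).
      by rewrite !map_rcons vsh map_shape_dir // => z /c'A/A0.
    move=> z; rewrite mem_rcons inE => /predU1P[->//|/mapP[w /c'A/A0 w0 ->]].
    exact: dir_S.
  move=> /(_ wb c (half (size c).+1 s) _ _ erefl _ yA m1 md) step.
  have {}step := ltW (step _); rewrite half_cons /=.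
  have := IH (rcons c (r c y)); rewrite !cat_rcons !size_rcons => IH'.
  rewrite -(subrKA (f (c ++ r c y :: half (size c).+1 s))) (le_trans (ler_normD _ _)) //.
  (* The budget eta/2/2^k splits into one change of scalar and the later ones. *)
  rewrite [leRHS](splitr (eta / 2 / 2 ^+ size c)) -[X in _ <= X + X]mulrA -invfM -exprSr.
  apply: lerD.
    move: step; rewrite size_rcons size_map; apply.
    apply: (fin_block_shape he A0 cb); first by rewrite !map_cat /= vsh hsh.
    move=> z; rewrite mem_cat => /orP[/c'A//|]; rewrite inE => /predU1P[->|/hA//].
    exact: S_infty_A.
  apply: IH'; apply: (fin_block_shape he A0 cb); first by rewrite !map_cat /= msh.
  by move=> z; rewrite mem_cat => /orP[/c'A//|]; rewrite inE => /predU1P[->|/sA//].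
move=> u ub; have /(fin_block_basisP he)[uA _ _] := ub.
have {tail_bound} := tail_bound u [::] ub; rewrite expr0 divr1 /= => t1.
have t2 : `|f u - f (half 0%N u)| < eta / 2.
  have u0 z : z \in u -> z != 0 by move=> /uA/A0.
  have repsP k s : (forall y, y \in s -> A_infty e y) ->
      (forall y, y \in reps k s -> S_infty e y) /\ map (shape e) (reps k s) = map (shape e) s.
    elim: s k => // y s IH k sA; have yA := sA y (mem_head _ _); have y0 := A0 y yA.
    have [|hA hs] := IH k.+1; first by move=> z zs; apply: sA; rewrite inE zs orbT.
    have [rS rsh _ _] := repS k _ (dir_S he y0); split.
      by move=> z; rewrite inE => /predU1P[->|/hA//].
    by rewrite /= hs rsh /shape supp_start_dir // supp_end_dir.
  have [rS rsh] := repsP 0%N u uA.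
  rewrite -{1}(scale_dir he u0); apply: Uf; rewrite ?size_map //.
  - apply: (fin_block_shape he S0 ub); first exact: map_shape_dir.
    by move=> z /mapP[w /u0 w0 ->]; apply: dir_S.
  - exact: (fin_block_shape he S0 ub).
  - move=> j ju; rewrite reps_nth // (nth_map 0) //.
    by have [_ _ _] := repS j _ (dir_S he (u0 _ (mem_nth 0 ju))).
  - by move=> a /mapP[w /uA wA ->].
rewrite -(subrKA (f (half 0%N u))) (le_trans (ler_normD _ _)) // [leRHS](splitr eta).
by apply: lerD => //; apply: ltW.
Qed.
End Rounding.

(** * The game on rounded sequences *)

Section Game.
Variables (K : numFieldType) (E : lmodType K) (e : nat -> E).
Hypothesis he : hamel_basis e.
Implicit Types (y z : E) (u c : seq E) (X Y Z : set E).

Variable r : seq E -> E -> E.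
Hypothesis rP : forall c y, A_infty e y ->
  [/\ A_infty e (r c y), supp_start e (r c y) = supp_start e y & supp_end e (r c y) = supp_end e y].
Hypothesis r_fin : forall c N, exists l : seq E,
  forall y, A_infty e y -> (supp_end e y <= N)%N -> r c y \in l.

Let next c y := rcons c (r c y).
Let blockA u := fin_block_basis e (A_infty e) u.
Let B X := block_subspaces e X.

Lemma round_rcons u y : round r (rcons u y) = next (round r u) y.
Proof. by rewrite /round foldl_rcons. Qed.

Lemma round_shape u : (forall x, x \in u -> A_infty e x) ->
  (forall x, x \in round r u -> A_infty e x) /\ map (shape e) (round r u) = map (shape e) u.
Proof.
elim/last_ind: u => // u y IH uA.
have [|cA csh] := IH; first by move=> x xu; apply: uA; rewrite mem_rcons inE xu orbT.
have yA : A_infty e y by apply: uA; rewrite mem_rcons mem_head.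
have [rA rs re] := rP (round r u) yA.
rewrite round_rcons; split=> [x|].
  by rewrite mem_rcons inE => /predU1P[->|/cA].
by rewrite !map_rcons csh /shape rs re.
Qed.

Lemma level_round u : blockA u -> level e (round r u) = level e u.
Proof.
by move=> /(fin_block_basisP he)[/round_shape[_ csh] _ _]; apply: level_shape.
Qed.

Lemma blockA_rcons u y : blockA (rcons u y) <-> [/\ blockA u, A_infty e y & (level e u <= supp_start e y)%N].
Proof. by apply: fin_block_rcons => // x /A_infty_neq0; apply. Qed.

(** The length of a block sequence is bounded by its level, and each rounded entry
has finitely many possible values once the rounded past is known. *)
Lemma finitely_many_rounded N : exists l : seq (seq E),
  forall u, blockA u -> (level e u <= N)%N -> round r u \in l.
Proof.
have /choice[L LP] := fun c => r_fin c N.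
have [l lP] : exists l : seq (seq E), forall u, blockA u -> (level e u <= N)%N ->
    (size u <= N)%N -> round r u \in l.
  elim: {2}N => [|n [l IH]]; first by exists [:: [::]] => -[].
  exists ([::] :: [seq rcons c z | c <- l, z <- L c]).
  case/lastP => [|u y]; first by rewrite mem_head.
  move=> /blockA_rcons[ub yA uy]; rewrite level_rcons size_rcons ltnS => yN un.
  rewrite inE round_rcons; apply/orP; right; apply: (allpairs_f_dep (fun c z => rcons c z)).
    by apply: IH => //; apply: leq_trans uy (leq_trans (ltnW (supp_start_lt_end he _)) yN); apply: A_infty_neq0 yA.
  exact: LP.
exists l => u ub uN; apply: lP => //; apply: leq_trans uN.
by apply: (size_le_level he _ ub) => x /A_infty_neq0; apply.
Qed.

Lemma dense_all (D : seq E -> set E -> Prop) X (l : seq (seq E)) :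
  (forall c Y Z, Z `<=` Y -> D c Y -> D c Z) ->
  (forall c Y, B Y -> Y `<=` X -> exists Z, [/\ B Z, Z `<=` Y & D c Z]) ->
  forall Y, B Y -> Y `<=` X ->
    exists Z, [/\ B Z, Z `<=` Y & forall c, c \in l -> D c Z].
Proof.
move=> Dsub Ddense; elim: l => [|c l IH] Y BY YX; first by exists Y; split.
have [Z [BZ ZY lZ]] := IH Y BY YX.
have [Z' [BZ' Z'Z cZ']] := Ddense c Z BZ (subset_trans ZY YX).
exists Z'; split=> //; first exact: subset_trans ZY.
by move=> c' /predU1P[->//|/lZ]; apply: Dsub.
Qed.

Variable T : set (seq E).

Definition legal c y := A_infty e y /\ (level e c <= supp_start e y)%N.

(** The moves of the second player are given by a function g, rather than by an
existential, so that the generated induction principle gives an induction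
hypothesis for the positions reached. *)
Inductive wins X c : Prop :=
| wins_now of T c
| wins_move (g : set E -> E) of
    (forall Y, B Y -> Y `<=` X -> Y (g Y) /\ legal c (g Y)) &
    (forall Y, B Y -> Y `<=` X -> wins X (next c (g Y))).

Lemma wins_some X c :
  (forall Y, B Y -> Y `<=` X -> exists y, [/\ Y y, legal c y & wins X (next c y)]) ->
  wins X c.
Proof.
move=> h; have /choice[g gP] : forall Y, exists y, B Y -> Y `<=` X ->
    [/\ Y y, legal c y & wins X (next c y)].
  move=> Y; have [[BY YX]|no] := pselect (B Y /\ Y `<=` X).
    by have [y yP] := h Y BY YX; exists y.
  by exists 0 => BY YX; case: no.
by apply: (@wins_move _ _ g) => Y BY YX; have [] := gP Y BY YX.
Qed.

Definition almost_sub Y X := exists m, Y `&` tail_space e m `<=` X.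

Lemma sub_almost Y X : Y `<=` X -> almost_sub Y X.
Proof. by move=> YX; exists 0%N => y [/YX]. Qed.

Lemma almost_trans Y X Z : almost_sub Y X -> almost_sub X Z -> almost_sub Y Z.
Proof.
move=> [m mP] [n nP]; exists (maxn m n) => y [Yy /(tail_spaceP he) yt].
apply: nP; split; last by apply/(tail_spaceP he) => j jn; rewrite yt // leq_max jn orbT.
by apply: mP; split=> //; apply/(tail_spaceP he) => j jm; rewrite yt // leq_max jm.
Qed.

(** Against a subspace of Y, answer as against its tail, which lies in X. *)
Lemma wins_almost X Y c : almost_sub Y X -> wins X c -> wins Y c.
Proof.
move=> [m YX]; elim=> [c' Tc|c' g gP _ IH]; first exact: wins_now.
apply: wins_some => Z BZ ZY; have [Z' [BZ' Z'Z Z'm]] := block_tail he m BZ.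
have Z'X : Z' `<=` X by move=> z Z'z; apply: YX; split; [apply/ZY/Z'Z|apply: Z'm].
have [Zg lg] := gP Z' BZ' Z'X.
by exists (g Z'); split; [apply: Z'Z| |apply: IH].
Qed.

(** Losing is required for all block subspaces almost contained in X, which makes it
hereditary, like winning; the negation of wins X c need not be. *)
Definition lost X c := forall Y, B Y -> almost_sub Y X -> ~ wins Y c.

Lemma lost_almost X Y c : almost_sub Y X -> lost X c -> lost Y c.
Proof. by move=> YX lX Z BZ ZY; apply: lX => //; apply: almost_trans YX. Qed.

(** A single position is decided by passing to a subspace below which it is winning,
if there is one.  Finitely many positions of level at most N are decided in turn,
and fusion handles all levels: since both alternatives are insensitive to initial
blocks, X inherits the decision from any subspace that almost contains it. *)
Lemma exists_deciding : exists2 X, B X & forall u, blockA u ->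
  wins X (round r u) \/ lost X (round r u).
Proof.
pose D c X := wins X c \/ lost X c.
have Dal c X Y : almost_sub Y X -> D c X -> D c Y.
  by move=> YX [/(wins_almost YX)|/(lost_almost YX)]; [left|right].
have Ddense c Y : B Y -> exists Z, [/\ B Z, Z `<=` Y & D c Z].
  move=> BY; have [[Z [BZ ZY Zc]]|no] := pselect (exists Z, [/\ B Z, almost_sub Z Y & wins Z c]).
    have [m mP] := ZY; have [Z' [BZ' Z'Z Z'm]] := block_tail he m BZ.
    exists Z'; split=> // [z Z'z|]; first by apply: mP; split; [apply: Z'Z|apply: Z'm].
    by left; apply: wins_almost Zc; apply: sub_almost.
  by exists Y; split=> //; right=> Z BZ ZY Zc; apply: no; exists Z.
pose Q N X := forall u, blockA u -> (level e u <= N)%N -> D (round r u) X.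
have [||X [BX _ XQ]] := @fusion _ _ _ he Q _ (block_full he).
- by move=> N Y Z ZY QY u ub uN; apply: Dal (QY u ub uN); apply: sub_almost.
- move=> N Y BY _; have [l lP] := finitely_many_rounded N.
  have [| | |Z [BZ ZY ZD]] := @dense_all D setT l _ _ Y BY.
  + by move=> c Y' Z /sub_almost; apply: Dal.
  + by move=> c Y' BY' _; apply: Ddense.
  + by [].
  + by exists Z; split=> // u ub uN; apply/ZD/lP.
exists X => // u ub; have [x Xx [x0 ux]] := block_vec he (level e u) BX.
have [Z QZ XZ] := XQ x Xx.
apply: (@Dal _ Z); first by exists (supp_end e x).
by apply: QZ => //; apply: leq_trans ux (ltnW (supp_start_lt_end he x0)).
Qed.

(** Let X decide all positions and suppose that the empty one is lost.  If c is lost,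
every Y inside X contains a subspace Z whose vectors only extend c to lost
positions: otherwise every such Z would contain a winning move, and c would be
winning below Y.  Fusion makes this hold for all positions at once, in one
subspace Z, all of whose block sequences are then lost. *)
Lemma exists_winning :
  (forall X, B X -> exists u, [/\ blockA u, forall x, x \in u -> X x & T (round r u)]) ->
  exists2 X, B X & wins X [::].
Proof.
move=> large; have [X BX Xdec] := exists_deciding.
case: (Xdec [::] (fin_block0 he _)) => [|lost0]; first by exists X.
exfalso.
pose D c Z := forall u, blockA u -> c = round r u -> lost X c ->
  forall z, Z z -> legal c z -> lost X (next c z).
have Dsub c Y Z : Z `<=` Y -> D c Y -> D c Z.
  by move=> ZY DY u ub cu lc z /ZY; apply: DY ub cu lc z.
have Ddense c Y : B Y -> Y `<=` X -> exists Z, [/\ B Z, Z `<=` Y & D c Z].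
  move=> BY YX; apply: contrapT => no.
  have [u [ub cu lc]] : exists u, [/\ blockA u, c = round r u & lost X c].
    apply: contrapT => nou; apply: no; exists Y; split=> // u ub cu lc.
    by case: nou; exists u.
  apply: (lc Y BY (sub_almost YX)); apply: wins_some => Z BZ ZY.
  apply: contrapT => noz; apply: no; exists Z; split=> // _ _ _ _ z Zz lz.
  have [zA cz] := lz.
  have uzb : blockA (rcons u z) by apply/blockA_rcons; split=> //; rewrite -level_round -?cu.
  have := Xdec _ uzb; rewrite round_rcons -cu => -[wz|//]; exfalso; apply: noz.
  by exists z; split=> //; apply: wins_almost wz; apply: sub_almost.
pose Q N Z := forall u, blockA u -> (level e u <= N)%N -> D (round r u) Z.
have [||Z [BZ ZX ZQ]] := @fusion _ _ _ he Q _ BX.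
- by move=> N Y Z ZY QY u ub uN; apply: Dsub (QY u ub uN).
- move=> N Y BY YX; have [l lP] := finitely_many_rounded N.
  have [Z [BZ ZY ZD]] := @dense_all D X l Dsub Ddense Y BY YX.
  by exists Z; split=> // u ub uN; apply/ZD/lP.
have Zlost u : blockA u -> (forall x, x \in u -> Z x) -> lost X (round r u).
  elim/last_ind: u => // u z IH /blockA_rcons[ub zA uz] uZ.
  have uZ' x : x \in u -> Z x by move=> xu; apply: uZ; rewrite mem_rcons inE xu orbT.
  have [x Zx ux] : exists2 x, Z x & supp_end e x = level e u.
    case/lastP: u uZ' {IH ub uz uZ} => [|u x] uZ'.
      by exists 0; [have [A ->] := block_span BZ; apply: lin_span0|rewrite supp_end0].
    by exists x; [apply: uZ'; rewrite mem_rcons mem_head|rewrite level_rcons].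
  have [Z' QZ' ZZ'] := ZQ x Zx; rewrite round_rcons.
  apply: (QZ' u ub _ u) => //; rewrite ?ux //; first exact: IH.
    apply: ZZ'; split; first by apply: uZ; rewrite mem_rcons mem_head.
    by rewrite ux; apply/(tail_space_start he) => //; apply: A_infty_neq0 zA.
  by split=> //; rewrite level_round.
have [u [ub uZ Tu]] := large Z BZ.
exact: (Zlost u ub uZ Z BZ (sub_almost ZX) (wins_now _ Tu)).
Qed.

(** * From winning positions to strategies *)

Lemma fin_block_setT u : fin_block_basis e setT u <-> fin_block_basis e [set x | x != 0] u.
Proof. by rewrite !fin_block_basisP //; split=> -[]. Qed.

Lemma exists_strategy : exists Phi, strategy e Phi.
Proof.
have /choice[p pP] : forall q : seq E * set E, exists x, B q.2 ->
    [/\ q.2 x, x != 0 & (level e q.1 <= supp_start e x)%N].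
  move=> [u V]; have [BV|] := pselect (B V); last by exists 0.
  by have [x Vx [x0 ux]] := block_vec he (level e u) BV; exists x.
exists (fun u V => rcons u (p (u, V))) => u V ub BV.
have [Vx x0 ux] := pP (u, V) BV; split; last by exists (p (u, V)).
by apply/fin_block_setT/(fin_block_rcons he) => //; split=> //; apply/fin_block_setT.
Qed.

Fixpoint play_from (Phi : seq E -> set E -> seq E) u (Vs : nat -> set E) n : seq E :=
  if n is n'.+1 then Phi (play_from Phi u Vs n') (Vs n') else u.

Lemma play_fromE Phi Vs n : play Phi Vs n = play_from Phi [::] Vs n.
Proof. by elim: n => //= n ->. Qed.

Lemma play_fromS Phi u Vs n :
  play_from Phi u Vs n.+1 = play_from Phi (Phi u (Vs 0%N)) (Vs \o S) n.
Proof. by elim: n => //= n <-. Qed.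

Definition reaches Phi X u := forall Vs : nat -> set E,
  (forall j, B (Vs j) /\ Vs j `<=` X) ->
  exists n, blockA (play_from Phi u Vs n) /\ T (round r (play_from Phi u Vs n)).

(** A strategy sees the current position but not the subspaces played before.  After
the first answer y it follows a strategy attached to y alone; the entry of index
size u of the current position reveals y. *)
Lemma wins_strategy X c : wins X c -> forall u, blockA u -> round r u = c ->
  exists2 Phi, strategy e Phi & reaches Phi X u.
Proof.
have [Phi0 Phi0P] := exists_strategy.
elim=> {c} [c Tc|c g gP _ IH] u ub uc.
  by exists Phi0 => // Vs _; exists 0%N; rewrite /= uc.
have /choice[F FP] : forall y, exists Phi, strategy e Phi /\
    ((exists Y, [/\ B Y, Y `<=` X & y = g Y]) -> reaches Phi X (rcons u y)).
  move=> y; have [[Y [BY YX yg]]|no] := pselect (exists Y, [/\ B Y, Y `<=` X & y = g Y]); last first.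
    by exists Phi0.
  have [yY [yA cy]] := gP Y BY YX; rewrite -yg in yY yA cy.
  have [||Phi PhiP Phir] := IH Y BY YX (rcons u y).
  - by apply/blockA_rcons; split=> //; rewrite -level_round ?uc.
  - by rewrite round_rcons uc yg.
  by exists Phi.
pose Phi w V : seq E := if w == u then if `[< B V /\ V `<=` X >] then rcons u (g V) else Phi0 w V
  else F (nth 0 w (size u)) w V.
have PhiP : strategy e Phi.
  move=> w V wb BV; rewrite /Phi; case: eqVneq => [wu|_]; last first.
    by have [+ _] := FP (nth 0 w (size u)); apply.
  case: asboolP => [[_ VX]|_]; last exact: Phi0P.
  have [Vg [gA cg]] := gP V BV VX; split; last by exists (g V); rewrite // wu.
  apply: (@fin_block_sub _ _ e (A_infty e)) => //; apply/blockA_rcons; split=> //.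
  by rewrite -level_round ?uc.
exists Phi => // Vs VsP; have [BV0 V0X] := VsP 0%N.
have Phi_u : Phi u (Vs 0%N) = rcons u (g (Vs 0%N)).
  by rewrite /Phi eqxx; case: asboolP => // -[].
set y := g (Vs 0%N) in Phi_u.
have [Fy_str Fy] := FP y.
have [||n nP] := Fy _ (Vs \o S).
- by exists (Vs 0%N).
- by move=> j; apply: (VsP j.+1).
have uyb : blockA (rcons u y).
  have [_ [yA cy]] := gP _ BV0 V0X.
  by apply/blockA_rcons; split=> //; rewrite -level_round ?uc.
exists n.+1; rewrite play_fromS Phi_u.
suff -> : play_from Phi (rcons u y) (Vs \o S) n = play_from (F y) (rcons u y) (Vs \o S) n by [].
have [//] : play_from Phi (rcons u y) (Vs \o S) n = play_from (F y) (rcons u y) (Vs \o S) n /\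
  fin_block_basis e setT (play_from (F y) (rcons u y) (Vs \o S) n) /\
  exists s, play_from (F y) (rcons u y) (Vs \o S) n = rcons u y ++ s.
elim: n {nP} => [|n [eqn [bn [s sE]]]] /=.
  by split=> //; split; [apply: fin_block_sub uyb|exists [::]; rewrite cats0].
have BVn : B (Vs n.+1) by have [] := VsP n.+1.
have [bn' [x _ xE]] := Fy_str _ _ bn BVn.
rewrite eqn; split; last first.
  by split=> //; exists (rcons s x); rewrite xE sE rcons_cat.
rewrite /Phi sE cat_rcons nth_cat ltnn subnn /=; case: eqP => // /(congr1 size)/eqP.
by rewrite size_cat /= -{2}[size u]addn0 eqn_add2l.
Qed.

End Game.

(** * Effective strategies for admissible functions *)

Section Effective.
Variables (K : numFieldType) (E : lmodType K) (e : nat -> E).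
Hypotheses (he : hamel_basis e) (hK : bounded_nets K).
Variables (R : realType) (f : seq E -> R).
Hypothesis hf : admissible e f.
Implicit Types (u v : seq E) (W : set E).

Let inf_tail W m : \bar R :=
  ereal_inf [set Defs.extended e f v | v in
      [set v : seq E | (0 < size v)%N /\ forall x, x \in v -> (W `&` tail_space e m) x]].

Lemma inf_tail_mono W : nondecreasing_seq (inf_tail W).
Proof.
move=> m n mn; apply: ereal_inf_le_tmp => _ [v [v0 vW] <-]; exists v => //; split=> // x /vW.
move=> [Wx /(tail_spaceP he) xn]; split=> //; apply/(tail_spaceP he) => j jm.
by apply: xn; apply: leq_trans mn.
Qed.

Lemma lower_limit_nil W : lower_limit e f W [::] = ereal_sup (range (inf_tail W)).
Proof. exact/cvg_lim/ereal_nondecreasing_cvgn/inf_tail_mono. Qed.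

Lemma inf_tail_ge0 W m : (0 <= inf_tail W m)%E.
Proof.
case: hf => f0 _ _ _; apply: le_ereal_inf_tmp => _ [v _ <-]; rewrite /Defs.extended.
by case: asboolP => [/f0|_]; rewrite ?lee_fin ?leey.
Qed.

Lemma inf_tail_bounded : exists M : R, forall W m,
  block_subspaces e W -> (inf_tail W m <= M%:E)%E.
Proof.
case: hf => _ [M fM] _ _; exists M => W m BW.
have [x Wx [xA mx]] := block_vecA he m BW.
have xb : fin_block_basis e (A_infty e) [:: x].
  by apply/(fin_block_basisP he); split=> // y; rewrite inE => /eqP->; rewrite ?(A_infty_neq0 he).
apply: (@le_trans _ _ (Defs.extended e f [:: x])); last by rewrite /Defs.extended asboolT // lee_fin fM.
apply: ereal_inf_lbound; exists [:: x] => //; split=> // y; rewrite inE => /eqP->; split=> //.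
by apply/(tail_space_start he) => //; apply: A_infty_neq0 xA.
Qed.

Let theta := ereal_sup [set lower_limit e f W [::] | W in block_subspaces e].

(** Boundedness of f makes the supremum real: every tail of a block subspace
contains a vector of A_infty, which is a block sequence of length 1. *)
Lemma theta_fin : exists t : R, theta = t%:E.
Proof.
suff: theta \is a fin_num by move=> /fineK <-; exists (fine theta).
have [M MP] := inf_tail_bounded.
have tM : (theta <= M%:E)%E.
  apply: ge_ereal_sup => _ [W BW <-]; rewrite lower_limit_nil.
  by apply: ge_ereal_sup => _ [m _ <-]; apply: MP.
have t0 : (0 <= theta)%E.
  apply: (@le_trans _ _ (lower_limit e f setT [::])).
    rewrite lower_limit_nil; apply: (le_trans (inf_tail_ge0 setT 0)).
    by apply: ereal_sup_ubound; exists 0%N.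
  by apply: ereal_sup_ubound; exists setT => //; apply: block_full.
by rewrite ge0_fin_numE // (le_lt_trans tM) // ltry.
Qed.

Lemma theta_approx (t eta : R) W : theta = t%:E -> 0 < eta -> block_subspaces e W ->
  exists v, [/\ v != [::], fin_block_basis e (A_infty e) v,
    forall x, x \in v -> W x & f v < t + eta].
Proof.
move=> tE eta0 BW.
have : (inf_tail W 0 < (t + eta)%:E)%E.
  apply: (@le_lt_trans _ _ theta); last by rewrite tE lte_fin ltrDl.
  apply: (@le_trans _ _ (lower_limit e f W [::])); last by apply: ereal_sup_ubound; exists W.
  by rewrite lower_limit_nil; apply: ereal_sup_ubound; exists 0%N.
move=> /ereal_inf_lt[_ [v [v0 vW] <-]]; rewrite /Defs.extended.
case: asboolP => // vb; rewrite lte_fin => fv; exists v; split=> //.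
  by rewrite -size_eq0 -lt0n.
by move=> x /vW[].
Qed.

Lemma effective_strategy (eps : R) : 0 < eps ->
  exists V Phi, [/\ block_subspaces e V, strategy e Phi & effective e f eps V Phi].
Proof.
move=> eps0; have eta0 : 0 < eps / 3 by rewrite divr_gt0.
have [t tE] := theta_fin.
have [r [rP r_fin rf]] := exists_rounding he hK hf eta0.
pose T : set (seq E) := [set c | c != [::] /\ f c < t + eps / 3 + eps / 3].
have round_near u : fin_block_basis e (A_infty e) u ->
    f u <= f (round r u) + eps / 3 /\ f (round r u) <= f u + eps / 3.
  by move=> /rf; rewrite ler_distlC => /andP[? ?]; split; lra.
have round_nil u : (round r u == [::]) = (u == [::]).
  by case/lastP: u => // u x; rewrite round_rcons -!size_eq0 !size_rcons.
have [W BW|V BV wV] := @exists_winning _ _ _ he r rP r_fin T.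
  have [v [v0 vb vW fv]] := theta_approx tE eta0 BW; exists v; split=> //.
  split; first by rewrite round_nil.
  by have [_ ] := round_near v vb; lra.
have [Phi PhiP Phir] := wins_strategy he rP wV (fin_block0 he _) erefl.
exists V, Phi; split=> // Vs VsP; have [n [wb [w0 fw]]] := Phir Vs VsP.
rewrite -play_fromE in wb w0 fw.
exists n; first by case: n w0 {wb fw} => //; rewrite round_nil.
rewrite -/theta tE /Defs.extended asboolT // -EFinD lte_fin.
by have [] := round_near _ wb; lra.
Qed.

End Effective.

Theorem theorem3p8 (R : realType) (k : scalar_kind)
    (E : lmodType (scalar_field R k)) (e : nat -> E) (he : hamel_basis e)
    (f : seq E -> R) (hf : admissible e f) (eps : R) (heps : 0 < eps) :
  exists (V : set E) (Phi : seq E -> set E -> seq E),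
    [/\ block_subspaces e V, strategy e Phi & effective e f eps V Phi].
Proof.
by case: k E e he f hf => E e he f hf; apply: effective_strategy => //;
  [apply: bounded_nets_real|apply: bounded_nets_complex].
Qed.
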